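(* Let $n\ge2$ and let $\Omega\subset\mathbb R^n$ be a bounded Sobolev $(p,q)$-extension domain with $1\le q\le p<\infty$. Then there exists a strong extension operator $E_s:W^{1,p}(\Omega)\to W^{1,q}(\mathbb R^n)$ if and only if $|\partial\Omega|=0$.
   Context: $|\cdot|$ denotes $n$-dimensional Lebesgue measure and $B(x,r)$ is the ball of center $x$ and radius $r$. $W^{1,p}(\Omega)$ is the Sobolev space with norm $\|u\|_{W^{1,p}(\Omega)}=\|u\|_{L^p(\Omega)}+\|\nabla u\|_{L^p(\Omega)}$. A bounded extension operator is a (not necessarily linear) operator $E:W^{1,p}(\Omega)\to W^{1,q}(\mathbb R^n)$ with $E(u)|_\Omega\equiv u$ for every $u\in W^{1,p}(\Omega)$ and $\|E\|:=\sup_{u\ne0}\|E(u)\|_{W^{1,q}(\mathbb R^n)}/\|u\|_{W^{1,p}(\Omega)}<\infty$. A bounded domain $\Omega$ is a Sobolev $(p,q)$-extension domain if such an operator exists. A bounded extension operator $E_s:W^{1,p}(\Omega)\to W^{1,q}(\mathbb R^n)$ is a strong extension operator if, for every function $u\in W^{1,p}(\Omega)$ with $u|_{B(x,r)\cap\Omega}\equiv c$ for some ball $B(x,r)$ with $B(x,r)\cap\Omega\ne\emptyset$ and some constant $c\in\mathbb R$, we have $E_s(u)(y)=c$ for almost every $y\in B(x,r)\cap\partial\Omega$. *)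

(* Defs.v *)
From HB Require Import structures.
From mathcomp Require Import all_boot all_order all_algebra.
From mathcomp Require Import all_classical all_reals all_analysis.
From mathcomp Require Import measurable_realfun.
Set Implicit Arguments.
Unset Strict Implicit.
Unset Printing Implicit Defensive.
Import Order.TTheory GRing.Theory Num.Theory.
Import numFieldNormedType.Exports.
Local Open Scope classical_set_scope.
Local Open Scope ring_scope.

Fact borel_mx_display : measure_display.
Proof. exact: default_measure_display. Qed.

(** R^n is ['rV[R]_n].  The library norm on it is the sup norm, which gives the
    usual topology and bounded sets; Euclidean lengths and balls are [enorm] and
    [eball]. *)

Section borel_matrix.
Variables (R : realType) (m n : nat).

(** Borel sigma-algebra *)
Let borel_mx := [set A : set 'M[R]_(m, n) | open A].

HB.instance Definition _ := @isMeasurable.Build borel_mx_display 'M[R]_(m, n)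
  <<s borel_mx >> (@sigma_algebra0 _ setT borel_mx) (@sigma_algebraC _ borel_mx)
  (@sigma_algebra_bigcup _ setT borel_mx).

Lemma open_measurable_mx (A : set 'M[R]_(m, n)) : open A -> measurable A.
Proof. exact: sub_sigma_algebra. Qed.

Lemma measurable_coord_mx i j :
  measurable_fun [set: 'M[R]_(m, n)] (fun M => M i j).
Proof.
apply: (measurability _ (RGenOpens.measurableE R)).
move=> _ [_ [a [b ->] <-]]; rewrite setTI; apply: open_measurable_mx.
move: (@coord_continuous R m n i j) => /continuousP; apply; exact: interval_open.
Qed.

Definition rat_box (b : 'M[rat]_(m, n) * nat) : set 'M[R]_(m, n) :=
  ball (map_mx ratr b.1 : 'M[R]_(m, n)) b.2.+1%:R^-1.

Lemma open_bigcup_rat_box (U : set 'M[R]_(m, n)) : open U ->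
  U = \bigcup_b (if `[< rat_box b `<=` U >] then rat_box b else set0).
Proof.
move=> oU; apply/seteqP; split=> [M UM|M [b _]]; last first.
  by case: asboolP => // bU; exact: bU.
have /nbhs_ballP[e /= e0 eU] : nbhs M U by exact: open_nbhs_nbhs.
have [k kM] : exists k, k.+1%:R^-1 < e / 2 :> R.
  have e20 : 0 < e / 2 by rewrite divr_gt0.
  have /cvgrPdist_lt/(_ _ e20)[k _ /(_ k (leqnn k))] := @cvg_harmonic R.
  by rewrite /= sub0r normrN gtr0_norm ?invr_gt0 //; exists k.
have k0 : 0 < k.+1%:R^-1 :> R by rewrite invr_gt0.
have ratP i j : exists q : rat,
    M i j - k.+1%:R^-1 < ratr q < M i j + k.+1%:R^-1.
  have [|q] := @rat_in_itvoo R (M i j - k.+1%:R^-1) (M i j + k.+1%:R^-1).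
    by rewrite ltrBlDr -addrA ltrDl addr_gt0.
  by rewrite in_itv; exists q.
pose b := (\matrix_(i, j) sval (cid (ratP i j)), k).
have bM : rat_box b M.
  rewrite /rat_box /ball /=; split=> //= i j; rewrite !mxE.
  case: cid => q /= /andP[q1 q2].
  by rewrite /ball /= ltr_distl q1 q2.
exists b => //; case: asboolP => // bU; exfalso; apply: bU => N bN; apply: eU.
apply: (@le_ball _ _ _ (k.+1%:R^-1 + k.+1%:R^-1)).
  by rewrite [leRHS]splitr lerD // ltW.
exact: (ball_triangle (ball_sym bM)).
Qed.

Lemma measurable_fun_mx d (T : measurableType d) (f : T -> 'M[R]_(m, n)) :
  (forall i j, measurable_fun [set: T] (fun x => f x i j)) ->
  measurable_fun [set: T] f.
Proof.
move=> mf; have borelE : @measurable _ 'M[R]_(m, n) =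
  <<s [set A : set 'M[R]_(m, n) | open A] >> by [].
apply: (measurability _ borelE) => //.
move=> _ [U oU <-]; rewrite setTI (open_bigcup_rat_box oU) preimage_bigcup.
apply: countable_bigcupT_measurable => [|b].
  exact: countableP.
case: asboolP => _; last by rewrite preimage_set0.
rewrite (_ : _ @^-1` _ =
    \bigcap_(i in [set: 'I_m]) \bigcap_(j in [set: 'I_n]) (setT `&`
      (fun x => f x i j) @^-1` ball (ratr (b.1 i j) : R) b.2.+1%:R^-1)); last first.
  apply/seteqP; split => x /=.
    by move=> [_ xb] i _ j _; split => //=; move: (xb i j); rewrite !mxE.
  move=> xb; split => [|i j]; first by rewrite invr_gt0.
  by rewrite !mxE; have [] := xb i I j I.
apply: fin_bigcap_measurable => // i _.
apply: fin_bigcap_measurable => // j _.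
by apply: mf => //; exact: measurable_ball.
Qed.

End borel_matrix.

Section lebesgue_cons.
Variables (R : realType) (n : nat).

Definition cons_row (z : measurableTypeR R * 'rV[R]_n) : 'rV[R]_n.+1 :=
  row_mx (z.1 : R)%:M z.2 : 'rV[R]_(1 + n).

Definition uncons_row (x : 'rV[R]_n.+1) : measurableTypeR R * 'rV[R]_n :=
  (x 0 0, rsubmx (x : 'rV[R]_(1 + n))).

Lemma cons_rowK : cancel cons_row uncons_row.
Proof.
case=> t y; rewrite /uncons_row /cons_row row_mxKr; congr pair.
have := row_mxEl ((t : R)%:M : 'M[R]_(1, 1)) y 0 0.
rewrite [_%:M _ _]mxE eqxx mulr1n => rowE; rewrite -[RHS]rowE.
by congr (row_mx _ _ _ _); exact: ord_inj.
Qed.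

Lemma measurable_cons_row : measurable_fun [set: _] cons_row.
Proof.
apply: measurable_fun_mx => i j; rewrite /cons_row /=.
case: (fintype.split_ordP (j : 'I_(1 + n))) => k ->.
  rewrite (_ : (fun x => _) = fst); first exact: measurable_fst.
  by apply/funext => x; rewrite (row_mxEl ((x.1 : R)%:M) x.2 i k) !ord1 mxE.
apply: (eq_measurable_fun (fun x : measurableTypeR R * 'rV[R]_n => x.2 i k)).
  by move=> x _; rewrite (row_mxEr ((x.1 : R)%:M) x.2 i k).
exact: measurableT_comp (measurable_coord_mx _ _) measurable_snd.
Qed.

Lemma measurable_uncons_row : measurable_fun [set: _] uncons_row.
Proof.
apply/measurable_fun_pairP; split; first exact: measurable_coord_mx.
apply: measurable_fun_mx => i j; rewrite /comp /=.
under eq_fun do rewrite mxE.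
exact: measurable_coord_mx.
Qed.

Variable mu : {sigma_finite_measure set 'rV[R]_n -> \bar R}.

Definition lebesgue_cons : set 'rV[R]_n.+1 -> \bar R :=
  pushforward (lebesgue_measure \x mu)%E cons_row.

Let lebesgue_cons0 : lebesgue_cons set0 = 0%E.
Proof. by rewrite /lebesgue_cons /pushforward preimage_set0 measure0. Qed.

Let lebesgue_cons_ge0 A : (0 <= lebesgue_cons A)%E.
Proof. exact: (measure_ge0 (lebesgue_measure \x mu)%E). Qed.

Let lebesgue_cons_sigma_additive : semi_sigma_additive lebesgue_cons.
Proof.
rewrite /lebesgue_cons; apply: measure_semi_sigma_additive.
exact: measurable_cons_row.
Qed.

HB.instance Definition _ := isMeasure.Build _ _ _ lebesgue_cons
  lebesgue_cons0 lebesgue_cons_ge0 lebesgue_cons_sigma_additive.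

Let lebesgue_cons_sigma_finite : sigma_finite setT lebesgue_cons.
Proof.
have /sigma_finiteP[F [FT ndF Foo]] :=
  @sigma_finiteT _ _ _ (@lebesgue_measure R).
have /sigma_finiteP[G [GT ndG Goo]] := sigma_finiteT mu.
exists (fun k => uncons_row @^-1` (F k `*` G k)).
  rewrite -preimage_bigcup (_ : \bigcup_k _ = setT) ?preimage_setT//.
  apply/seteqP; split=> // -[t y] _.
  have [k _ Fkt] : (\bigcup_k F k) t by rewrite -FT.
  have [l _ Gly] : (\bigcup_k G k) y by rewrite -GT.
  exists (maxn k l) => //; split => /=.
    by move: t Fkt; exact/subsetPset/ndF/leq_maxl.
  by move: y Gly; exact/subsetPset/ndG/leq_maxr.
move=> k; have [mF Fk] := Foo k; have [mG Gk] := Goo k; split.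
  rewrite -[X in measurable X]setTI; apply: measurable_uncons_row => //.
  exact: measurableX.
rewrite /lebesgue_cons /pushforward -comp_preimage.
rewrite (_ : uncons_row \o cons_row = id); last first.
  by apply/funext => z; exact: cons_rowK.
by rewrite preimage_id product_measure1E// lte_mul_pinfty// ge0_fin_numE.
Qed.

HB.instance Definition _ := Measure_isSigmaFinite.Build _ _ _ lebesgue_cons
  lebesgue_cons_sigma_finite.

End lebesgue_cons.

(** n-dimensional Lebesgue measure on the Borel sets, as an iterated product of
    one-dimensional Lebesgue measures; ['rV[R]_0] is a point of mass 1. *)
Fixpoint vol (R : realType) (n : nat) :
    {sigma_finite_measure set 'rV[R]_n -> \bar R} :=
  match n with
  | 0 => [the {sigma_finite_measure set 'rV[R]_0 -> \bar R} of \d_(0 : 'rV[R]_0)]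
  | n'.+1 => [the {sigma_finite_measure set 'rV[R]_n'.+1 -> \bar R} of
               lebesgue_cons (vol R n')]
  end.

(** [measurable_fun] below is Borel measurability.  Every class of Lebesgue
    measurable functions modulo null sets has a Borel representative, so the
    spaces are the usual ones. *)
Section sobolev.
Variables (R : realType) (n : nat).
Local Notation "'Rn'" := 'rV[R]_n.
Implicit Types (Om : set Rn) (p q : R) (u v : Rn -> R) (x y : Rn).

Definition enorm x : R := Num.sqrt (\sum_(i < n) x 0 i ^+ 2).

Definition eball x (r : R) : set Rn := [set y | enorm (y - x) < r].

Definition boundary Om : set Rn := closure Om `\` interior Om.

Definition bounded_domain Om :=
  [/\ open Om, connected Om, Om !=set0 & bounded_set Om].

Definition partial (i : 'I_n) u : Rn -> R := 'D_(delta_mx 0 i) u.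

Definition smooth u := forall s : seq 'I_n,
  continuous (foldr partial u s) /\
  forall i x, derivable (foldr partial u s) x (delta_mx 0 i).

Definition test_function Om (phi : Rn -> R) :=
  let supp := closure [set x | phi x != 0] in
  [/\ smooth phi, compact supp & supp `<=` Om].

Definition loc_integrable Om u := measurable_fun Om u /\
  forall K, compact K -> K `<=` Om -> (vol R n).-integrable K (EFin \o u).

Definition weak_gradient Om u (g : Rn -> Rn) :=
  [/\ loc_integrable Om u,
      forall i, loc_integrable Om (fun x => g x 0 i) &
      forall phi i, test_function Om phi ->
        \int[vol R n]_(x in Om) (u x * partial i phi x) =
        - \int[vol R n]_(x in Om) (g x 0 i * phi x)].

(** Weak gradients are unique up to a null set, so the norms below do not depend
    on the choice made here. *)
Definition grad Om u : Rn -> Rn := xget (fun=> 0) [set g | weak_gradient Om u g].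

Definition Lp_norm Om p u : \bar R := 'N[vol R n]_p%:E [EFin \o (u \_ Om)].

Definition W1p_norm Om p u : \bar R :=
  (Lp_norm Om p u + Lp_norm Om p (enorm \o grad Om u))%E.

Definition W1p Om p : set (Rn -> R) := [set u |
  [/\ measurable_fun Om u, (Lp_norm Om p u < +oo)%E &
      exists2 g, weak_gradient Om u g & (Lp_norm Om p (enorm \o g) < +oo)%E]].

Definition ae_eq_on Om u v := {ae vol R n, forall x, Om x -> u x = v x}.

Definition opnorm Om p q (E : (Rn -> R) -> (Rn -> R)) : \bar R :=
  ereal_sup [set (W1p_norm setT q (E u) / W1p_norm Om p u)%E |
             u in [set u | W1p Om p u /\ ~ ae_eq_on Om u (fun=> 0)]].

(** Elements of [W1p] are functions rather than classes modulo null sets; the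
    second condition makes [E] an operator on classes. *)
Definition bounded_extension_operator Om p q (E : (Rn -> R) -> (Rn -> R)) :=
  [/\ forall u, W1p Om p u -> W1p setT q (E u),
      forall u v, W1p Om p u -> W1p Om p v -> ae_eq_on Om u v ->
        ae_eq_on setT (E u) (E v),
      forall u, W1p Om p u -> ae_eq_on Om (E u) u &
      (opnorm Om p q E < +oo)%E].

Definition sobolev_extension_domain Om p q :=
  bounded_domain Om /\ exists E, bounded_extension_operator Om p q E.

Definition strong_extension_operator Om p q (E : (Rn -> R) -> (Rn -> R)) :=
  bounded_extension_operator Om p q E /\
  forall u, W1p Om p u -> forall x r (c : R),
    eball x r `&` Om !=set0 ->
    ae_eq_on (eball x r `&` Om) u (fun=> c) ->
    ae_eq_on (eball x r `&` boundary Om) (E u) (fun=> c).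

End sobolev.

(* Main.v *)
(** If the boundary K has measure zero, every extension operator is strong.

    Conversely, let E be a strong extension operator and suppose |K| > 0.  For
    small h take u = h W(x_1 / h) eta, where W is a periodic wave with plateaus
    0 and 1 exchanged by the half-period shift and eta is a cutoff equal to 1
    near K and to 0 on Om outside a set of small measure.  As h -> 0 the
    gradient of u is bounded on that small set and O(h) elsewhere, so the
    W^{1,p} norm of u, hence the W^{1,q} norm of v = E u, is as small as we
    like.  The strong extension property forces v = 0, resp. v = h, almost
    everywhere on the part of K lying over the lower, resp. upper, plateau.  On
    the set A of points x of K over the lower plateau with x + h e_1 in K we get
    h = v(x + h e_1) - v(x) = int_0^h (d_1 v)(x + s e_1) ds, so |A| is bounded
    by the W^{1,q} norm of v.  Four phases of the wave (+-sin, +-cos) cover K up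
    to the small set of x with x + h e_1 outside K, hence |K| is arbitrarily
    small. *)
Require Import Defs.
From HB Require Import structures.
From mathcomp Require Import all_boot all_order all_algebra.
From mathcomp Require Import all_classical all_reals all_analysis.
From mathcomp Require Import measurable_realfun ring lra.
Import Order.TTheory GRing.Theory Num.Theory.
Import numFieldNormedType.Exports.
Local Open Scope classical_set_scope.
Local Open Scope ring_scope.

(** * Translation invariance of [vol] *)

(** Amplitude and half-period of the wave are both h. This makes the argument scale invariant: the
    slope of the wave has a bound independent of h, and a jump of h over a distance h is a
    difference quotient equal to 1, so the estimate for |A| does not deteriorate as h tends to 0.
    The cutoff must be fixed before h: its gradient may be huge, but it gets multiplied by h, so
    that only the slope of the wave survives, on a set whose measure was chosen in advance against
    that slope. The obstacle on the side of v is that it is known only through its weak gradient.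
    For each fixed h the formula for v(x + h e_1) - v(x) is therefore proved by duality. Tested
    against a bump, the left side becomes minus the integral of v times the derivative of an
    averaged bump; by Fubini the right side becomes the integral of d_1 v times that same averaged
    bump. Integrating over A, the inequality t <= 1/2 + 2^(q-1) t^q applied to t = |d_1 v| lets half
    of |A| be absorbed and leaves the q-th power of an L^q norm, for all q >= 1 alike. *)

Section translation.
Context {R : realType}.

Lemma measurable_addr (c : R) :
  measurable_fun [set: measurableTypeR R] (fun t : measurableTypeR R => (t + c : R) : measurableTypeR R).
Proof. exact: measurable_funD. Qed.

(** Lebesgue measure is determined by its values on half-open intervals, whose length a shift
    preserves. *)
Lemma lebesgue_translate (c : R) (A : set (measurableTypeR R)) : measurable A ->
  lebesgue_measure ((fun t => t + c) @^-1` A) = lebesgue_measure A.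
Proof.
move=> mA; apply/esym.
pose m := [the {measure set (measurableTypeR R) -> \bar R} of
  pushforward (@lebesgue_measure R) (fun t : measurableTypeR R => (t + c : R) : measurableTypeR R)].
rewrite -[RHS]/(m (measurable_addr c) A).
apply: lebesgue_measure_unique; last exact: mA.
move=> _ [[a b] /= _ <-]; rewrite /m /= /pushforward.
rewrite (_ : _ @^-1` _ = [set` `](a - c), (b - c)]]); last first.
  by apply/seteqP; split=> t /=; rewrite !in_itv/= ltrBlDr lerBrDr.
rewrite !lebesgue_measure_itv/= !lte_fin ltrD2r.
by case: ifP => // _; rewrite -!EFinB opprB addrA subrK.
Qed.

Lemma measurable_addmx n (c : 'rV[R]_n) :
  measurable_fun [set: 'rV[R]_n] (fun x => x + c).
Proof.
apply: measurable_fun_mx => i j.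
under eq_fun do rewrite mxE.
by apply: measurable_funD => //; exact: measurable_coord_mx.
Qed.

(** Induction on the dimension: seen through [cons_row] the shift is a product map, and uniqueness
    of the product measure reduces the claim to rectangles, where the one-dimensional case and the
    induction hypothesis apply factor by factor. *)
Lemma vol_translate n (c : 'rV[R]_n) (A : set 'rV[R]_n) : measurable A ->
  vol R n ((fun x => x + c) @^-1` A) = vol R n A.
Proof.
elim: n => [|n IH] in c A *.
  move=> mA; congr (vol R 0 _); apply/seteqP; split=> x /=;
  by have -> : x + c = x by apply/rowP => -[].
move=> mA.
pose c' : 'rV[R]_n := rsubmx (c : 'rV[R]_(1 + n)).
pose f (z : measurableTypeR R * 'rV[R]_n) : measurableTypeR R * 'rV[R]_n :=
  ((z.1 : R) + c 0 0, z.2 + c').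
have mf : measurable_fun setT f.
  apply/measurable_fun_pairP; split.
    exact: (measurableT_comp (measurable_addr _) measurable_fst).
  exact: (measurableT_comp (measurable_addmx _ _) measurable_snd).
pose m := [the {measure set _ -> \bar R} of
  pushforward (@lebesgue_measure R \x vol R n)%E f].
have mc : measurable (@cons_row R n @^-1` A).
  by rewrite -[X in measurable X]setTI; exact: measurable_cons_row.
transitivity (m mf (@cons_row R n @^-1` A)).
  rewrite /m /= /lebesgue_cons /pushforward; congr ((_ \x _)%E _).
  apply/seteqP; split => -[t y] /=; rewrite (_ : cons_row _ + c = cons_row (f (t, y)))//.
    apply/rowP => i; rewrite !mxE; case: fintype.splitP => j ij.
      rewrite !ord1 !mxE eqxx !mulr1n; congr (_ + c 0 _).
      by apply/val_inj; rewrite /= ij ord1.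
    rewrite !mxE; congr (_ + c _ _).
    by apply/val_inj; rewrite /= ij.
  apply/rowP => i; rewrite !mxE; case: fintype.splitP => j ij.
    rewrite !ord1 !mxE eqxx !mulr1n; congr (_ + c 0 _).
    by apply/val_inj; rewrite /= ij ord1.
  rewrite !mxE; congr (_ + c _ _).
  by apply/val_inj; rewrite /= ij.
apply/esym; rewrite -[LHS]/((lebesgue_measure \x vol R n)%E (@cons_row R n @^-1` A)).
apply: (@product_measure_unique _ _ _ _ _ (@lebesgue_measure R) (vol R n) (m mf) _ _ mc).
move=> B C mB mC; rewrite /m /= /pushforward.
rewrite (_ : f @^-1` _ = ((fun t => t + c 0 0) @^-1` B) `*` ((fun x => x + c') @^-1` C)); last first.
  by apply/seteqP; split=> -[].
rewrite product_measure1E.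
- by congr (_ * _)%E; [exact: lebesgue_translate|exact: IH].
- by rewrite -[X in measurable X]setTI; exact: measurable_addr.
- by rewrite -[X in measurable X]setTI; exact: measurable_addmx.
Qed.

Lemma integrable_translate n (c : 'rV[R]_n) (f : 'rV[R]_n -> \bar R) :
  measurable_fun setT f ->
  (vol R n).-integrable setT f -> (vol R n).-integrable setT (fun x => f (x + c)).
Proof.
move=> mf /integrableP[_ foo]; apply/integrableP; split.
  exact: measurableT_comp (measurable_addmx _ _).
have maf : measurable_fun setT (abse \o f) by exact: measurableT_comp.
have := @ge0_integral_pushforward _ _ _ _ _ _ (measurable_addmx n c) (vol R n) setT
  (abse \o f) measurableT maf (fun _ _ => abse_ge0 _).
rewrite preimage_setT /= => <-.
rewrite (eq_measure_integral (vol R n))//.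
  exact: measurable_addmx.
by move=> ? A mA _; exact: vol_translate.
Qed.

Lemma ge0_integral_translate n (c : 'rV[R]_n) (f : 'rV[R]_n -> \bar R) :
  measurable_fun setT f -> (forall x, 0 <= f x)%E ->
  (\int[vol R n]_x f (x + c)%R = \int[vol R n]_x f x)%E.
Proof.
move=> mf f0.
have := @ge0_integral_pushforward _ _ _ _ _ _ (measurable_addmx n c) (vol R n) setT
  f measurableT mf (fun _ _ => f0 _).
rewrite preimage_setT /= => <-.
apply: eq_measure_integral; first exact: measurable_addmx.
by move=> ? A mA _; exact: vol_translate.
Qed.

Lemma integral_translate n (c : 'rV[R]_n) (f : 'rV[R]_n -> \bar R) :
  (vol R n).-integrable setT f ->
  (\int[vol R n]_x f (x + c)%R = \int[vol R n]_x f x)%E.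
Proof.
move=> fi; have mf := measurable_int _ fi.
have := @integral_pushforward _ _ _ _ _ _ (measurable_addmx n c) (vol R n) setT f mf
  _ measurableT.
rewrite preimage_setT => /(_ (integrable_translate _ _ _ mf fi)) /= <-.
apply: eq_measure_integral; first exact: measurable_addmx.
by move=> ? A mA _; exact: vol_translate.
Qed.

Lemma negligible_translate n (c : 'rV[R]_n) (N : set 'rV[R]_n) :
  (vol R n).-negligible N -> (vol R n).-negligible ((fun x => x + c) @^-1` N).
Proof.
move=> [A [mA A0 NA]]; exists ((fun x => x + c) @^-1` A); split.
- by rewrite -[X in measurable X]setTI; exact: measurable_addmx.
- by have := vol_translate _ c _ mA; rewrite A0.
- by move=> x /=; exact: NA.
Qed.

Lemma ae_translate n (c : 'rV[R]_n) (P : 'rV[R]_n -> Prop) :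
  {ae vol R n, forall x, P x} -> {ae vol R n, forall x, P (x + c)}.
Proof. by move=> /(negligible_translate _ c); exact: negligibleS. Qed.

Lemma exists_invS_lt (e : R) : 0 < e -> exists k : nat, k.+1%:R^-1 < e.
Proof.
move=> e0; exists (Num.truncn e^-1).
by rewrite -[ltRHS]invrK ltf_pV2 ?posrE ?invr_gt0// truncnS_gt.
Qed.

Lemma coord_le_norm n (x : 'rV[R]_n) i : `|x 0 i| <= `|x|.
Proof.
rewrite /Num.norm /= mx_normrE.
exact: (le_bigmax _ (fun ij : 'I_1 * 'I_n => `|x ij.1 ij.2|) (0, i)).
Qed.

Lemma norm_le_coord n (x : 'rV[R]_n) r :
  0 <= r -> (forall i, `|x 0 i| <= r) -> `|x| <= r.
Proof.
move=> r0 xr; rewrite /Num.norm /= mx_normrE.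
by apply: bigmax_le => // -[i j] _; rewrite ord1; exact: xr.
Qed.

(** An induction on the dimension needs product sets, so it is run on cubes: each is enclosed in a
    measurable set of finite measure, the product of an interval with the enclosure one dimension
    lower. *)
Lemma vol_bounded n (A : set 'rV[R]_n) : measurable A -> bounded_set A ->
  (vol R n A < +oo)%E.
Proof.
have H : forall r : R, exists2 B, [set x : 'rV[R]_n | forall i, `|x 0 i| <= r] `<=` B &
    measurable B /\ (vol R n B < +oo)%E.
  elim: n {A} => [|n IH] r.
    by exists setT => //; split => //; rewrite /= diracT ltry.
  have [B HB [mB Boo]] := IH r.
  exists (@uncons_row R n @^-1` (`[-r, r]%classic `*` B)).
    move=> x /= xr; split => /=.
      by rewrite in_itv/= -ler_norml; exact: xr.
    by apply: HB => i /=; rewrite mxE; exact: xr.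
  split.
    rewrite -[X in measurable X]setTI; apply: measurable_uncons_row => //.
    exact: measurableX.
  rewrite /= /lebesgue_cons /pushforward -comp_preimage.
  rewrite (_ : uncons_row (n:=n) \o cons_row (n:=n) = id); last first.
    by apply/funext => z; exact: cons_rowK.
  have L : (lebesgue_measure ([set` `[(- r)%R, r]%R] : set (measurableTypeR R)) < +oo)%E.
    by rewrite lebesgue_measure_itv/=; case: ifP => //; rewrite ltry.
  by rewrite preimage_id product_measure1E// lte_mul_pinfty// ge0_fin_numE.
move=> mA [M [_ AM]].
have [B HB [mB Boo]] := H (M + 1).
apply: le_lt_trans Boo; apply: le_measure; rewrite ?inE//.
move=> x /AM-/(_ (M + 1)) xM; apply: HB => i /=.
apply: le_trans (xM _); last by rewrite ltrDl.
exact: coord_le_norm.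
Qed.

End translation.

(** * Smooth test functions approximating boxes *)

Section smooth1.
Context {R : realType}.
Implicit Types (F f : R -> R) (t : R).

(* The family is closed under differentiation up to linear combinations, see
   [is_derive_flat]; [flat 0] is the usual smooth flat function. *)
Definition flat (m : nat) t : R :=
  if 0 < t then t^-1 ^+ m * expR (- t^-1) else 0.

Lemma flat_ge0 m t : 0 <= flat m t.
Proof.
rewrite /flat; case: ifP => // t0.
by rewrite mulr_ge0 ?expR_ge0// exprn_ge0// invr_ge0 ltW.
Qed.

Lemma flat0_le1 t : flat 0 t <= 1.
Proof.
rewrite /flat; case: ifP => // t0; rewrite expr0 mul1r.
by rewrite -expR0 ler_expR oppr_le0 invr_ge0 ltW.
Qed.

Lemma flat_le0 m t : t <= 0 -> flat m t = 0.
Proof. by move=> t0; rewrite /flat ltNge t0. Qed.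

(** With s = 1/t this is the series bound s^(m+1) / (m+1)! <= exp(s). A bound linear in [t] is what
    the derivative at 0 requires. *)
Lemma flat_bound m t : 0 <= t -> flat m t <= (m.+1)`!%:R * t.
Proof.
rewrite le_eqVlt => /predU1P[<-|t0]; first by rewrite flat_le0// mulr0.
rewrite /flat t0; have s0 : 0 < t^-1 by rewrite invr_gt0.
have := expR_ge1Dxn m (ltW s0).
have f0 : 0 < (m.+1)`!%:R :> R by rewrite ltr0n fact_gt0.
move=> H; have {H} : t^-1 ^+ m.+1 / (m.+1)`!%:R <= expR t^-1.
  by apply: le_trans H; rewrite lerDr.
rewrite ler_pdivrMr// expRN ler_pdivrMr ?expR_gt0// => H.
rewrite mulrAC -ler_pdivrMr// -exprSr.
by rewrite mulrC.
Qed.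

Lemma is_derive_flat m t :
  is_derive t 1 (flat m) (flat m.+2 t - m%:R * flat m.+1 t).
Proof.
have [t0|t0|->] := ltgtP t 0.
- rewrite !flat_le0 ?mulr0 ?subr0 1?ltW//.
  apply: (@near_eq_is_derive R R^o R^o (cst 0) (flat m)).
  near=> y; rewrite flat_le0//; apply: ltW; near: y.
  exact: lt_nbhsl.
- have tn0 : t != 0 by rewrite gt_eqF.
  apply: (@near_eq_is_derive R R^o R^o (fun y : R => y^-1 ^+ m * expR (- y^-1)) (flat m)).
    near=> y; rewrite /flat ifT//; near: y.
    exact: lt_nbhsr.
  have dV : is_derive t 1 (fun y : R => y^-1) (- t ^- 2).
    have := @is_deriveV R id t 1 1 tn0 (is_derive_id t 1).
    by rewrite /GRing.scale/= mulr1.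
  have dX : is_derive t 1 (fun y : R => y^-1 ^+ m) (m%:R * t^-1 ^+ m.-1 * - t^-2).
    by have := @is_deriveX R _ (fun y : R => y^-1) m t 1 _ dV; rewrite exprfctE.
  have dE : is_derive t 1 (fun y : R => expR (- y^-1)) (expR (- t^-1) * t^-2).
    have := @is_derive1_comp R expR (fun y : R => - y^-1) t _ _ (is_derive_expR _)
      (is_deriveN dV).
    by rewrite opprK.
  have H := is_deriveM dX dE.
  apply: (@is_derive_eq _ _ _ _ _ _ _ _ H).
  rewrite /flat t0 /GRing.scale/=.
  case: m {dX H} => [|m].
    by rewrite !mul0r !mulr0 subr0 addr0 !expr0 exprS expr1; field.
  by rewrite -[in m.+1.-1]/m !exprS; field.
(* At 0 the difference quotient of [flat m] is [flat m.+1] for positive increments and 0 for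
   negative ones; [flat_bound] makes it tend to 0. *)
- rewrite !flat_le0 ?mulr0 ?subr0//.
  have H : (fun h : R => h^-1 *: ((flat m \o shift 0) (h *: 1) - flat m 0)) @ 0^' --> (0 : R).
    apply/cvgrPdist_le => e e0.
    near=> h.
    rewrite sub0r normrN /= addr0 /GRing.scale/= mulr1 (flat_le0 m 0)// subr0.
    have [h0|h0] := leP h 0; first by rewrite flat_le0// mulr0 normr0 ltW.
    rewrite (_ : h^-1 * _ = flat m.+1 h); last by rewrite /flat h0 exprS mulrA.
    rewrite ger0_norm ?flat_ge0// (le_trans (flat_bound _ _ (ltW h0)))//.
    rewrite mulrC -ler_pdivlMr ?ltr0n ?fact_gt0//.
    rewrite -(gtr0_norm h0).
    by near: h; apply: dnbhs0_le; rewrite divr_gt0// ltr0n fact_gt0.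
  apply: DeriveDef; first by apply/cvg_ex; exists 0.
  exact: cvg_lim H.
Unshelve. all: by end_near. Qed.

End smooth1.

Section smooth_functions.
Context {R : realType}.

(* A class of functions stable under differentiation, hence made of smooth
   functions; [elem] is its analogue on R^n. *)
Inductive elem1 : (R -> R) -> Prop :=
| elem1_flat m a b : elem1 (fun t => flat m (a * t + b))
| elem1_cst c : elem1 (fun=> c)
| elem1_add F G : elem1 F -> elem1 G -> elem1 (fun t => F t + G t)
| elem1_mul F G : elem1 F -> elem1 G -> elem1 (fun t => F t * G t)
| elem1_anti F f : elem1 f -> (forall t : R, is_derive t 1 F (f t)) -> elem1 F.

Lemma elem1_derive F : elem1 F ->
  exists2 f, elem1 f & forall t : R, is_derive t 1 F (f t).
Proof.
elim=> {F} [m a b|c|F G _ [f ef dF] _ [g eg dG]|F G eF [f ef dF] eG [g eg dG]|F f ef _ dF].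
- exists (fun t => a * (flat m.+2 (a * t + b) + - m%:R * flat m.+1 (a * t + b))).
    apply: elem1_mul; first exact: elem1_cst.
    apply: elem1_add; first exact: elem1_flat.
    by apply: elem1_mul; [exact: elem1_cst|exact: elem1_flat].
  move=> t.
  have dl : is_derive t 1 (fun y : R => a * y + b) a.
    have H : is_derive t 1 (fun y : R => a * y) (a * 1) := is_deriveZ a (is_derive_id t 1).
    have := is_deriveD H (is_derive_cst b t 1).
    by rewrite mulr1 addr0.
  have := @is_derive1_comp R (flat m) (fun y => a * y + b) t _ _ (is_derive_flat m _) dl.
  by rewrite mulrC mulNr.
- by exists (fun=> 0); [exact: elem1_cst|move=> t; exact: is_derive_cst].
- exists (fun t => f t + g t); first exact: elem1_add.
  by move=> t; exact: is_deriveD (dF t) (dG t).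
- exists (fun t => F t * g t + G t * f t).
    by apply: elem1_add; exact: elem1_mul.
  by move=> t; exact: is_deriveM (dF t) (dG t).
- by exists f.
Qed.

Lemma is_derive1_continuous (F : R -> R) (t d : R) : is_derive t 1 F d ->
  {for t, continuous F}.
Proof. by move=> [H _]; exact/differentiable_continuous/derivable1_diffP. Qed.

Lemma elem1_continuous F : elem1 F -> continuous F.
Proof.
by move=> /elem1_derive[f _ dF] t; exact: is_derive1_continuous (dF t).
Qed.

(** The difference quotients along [v] are those of a function of one variable. The offset [a]
    allows [F] to be read in the coordinate itself instead of the displacement from [x]. *)
Lemma is_derive_along (V : normedModType R) (f : V -> R) (x v : V) (F : R -> R) (a d : R) :
  (forall h, f (h *: v + x) = F (h + a)) -> is_derive a 1 F d -> is_derive x v f d.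
Proof.
move=> fF [dF <-].
have E : (fun h : R => h^-1 *: ((f \o shift x) (h *: v) - f x)) =
         (fun h : R => h^-1 *: ((F \o shift a) (h *: 1) - F a)).
  apply/funext => h /=; rewrite fF.
  by rewrite -[in LHS](add0r x) -(scale0r v) fF add0r /GRing.scale/= mulr1.
apply: DeriveDef; first by rewrite /derivable E.
by rewrite /derive E.
Qed.

Lemma is_derive_line (V : normedModType R) (f : V -> R) (x v : V) (a d : R) :
  is_derive (a *: v + x) v f d -> is_derive a 1 (fun t => f (t *: v + x)) d.
Proof.
move=> [df <-].
have E : (fun h : R => h^-1 *: (((fun t => f (t *: v + x)) \o shift a) (h *: 1) - f (a *: v + x))) =
         (fun h : R => h^-1 *: ((f \o shift (a *: v + x)) (h *: v) - f (a *: v + x))).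
  apply/funext => h /=; have -> : h *: (1 : R) = h by exact: mulr1.
  by rewrite scalerDl addrA.
by apply: DeriveDef; [rewrite /derivable E|rewrite /derive E].
Qed.

Context {n : nat}.

Inductive elem : ('rV[R]_n -> R) -> Prop :=
| elem_coord F i : elem1 F -> elem (fun x => F (x 0 i))
| elem_cst c : elem (fun=> c)
| elem_add f g : elem f -> elem g -> elem (fun x => f x + g x)
| elem_mul f g : elem f -> elem g -> elem (fun x => f x * g x).

Lemma is_derive_coord (F : R -> R) (i j : 'I_n) (x : 'rV[R]_n) (d : R) :
  is_derive (x 0 i) 1 F d ->
  is_derive x (delta_mx 0 j) (fun y : 'rV[R]_n => F (y 0 i)) ((i == j)%:R * d).
Proof.
have [->|ij] := eqVneq i j => dF.
  rewrite mul1r; apply: (@is_derive_along _ _ _ _ F (x 0 j)).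
  by move=> h; rewrite !mxE !eqxx mulr1.
rewrite mul0r; apply: (@is_derive_along _ _ _ _ (cst (F (x 0 i))) 0).
by move=> h; rewrite !mxE eqxx (negbTE ij) mulr0 add0r.
Qed.

Lemma elem_derive f i : elem f ->
  exists2 g, elem g & forall x, is_derive x (delta_mx 0 i) f (g x).
Proof.
elim=> {f} [F j eF|c|f g _ [f' ef df] _ [g' eg dg]|f g ef0 [f' ef df] eg0 [g' eg dg]].
- have [f ef dF] := elem1_derive _ eF.
  exists (fun x => (j == i)%:R * f (x 0 j)).
    by apply: elem_mul; [exact: elem_cst|exact: elem_coord].
  by move=> x; exact: is_derive_coord.
- by exists (fun=> 0); [exact: elem_cst|move=> t; exact: is_derive_cst].
- exists (fun t => f' t + g' t); first exact: elem_add.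
  by move=> t; exact: is_deriveD (df t) (dg t).
- exists (fun t => f t * g' t + g t * f' t).
    by apply: elem_add; exact: elem_mul.
  by move=> t; exact: is_deriveM (df t) (dg t).
Qed.

Lemma elem_continuous f : elem f -> continuous f.
Proof.
elim=> {f} [F j eF|c|f g _ cf _ cg|f g _ cf _ cg] x.
- apply: (@continuous_comp _ _ _ (fun y : 'rV[R]_n => y 0 j) F).
    exact: coord_continuous.
  exact: elem1_continuous.
- exact: cst_continuous.
- exact: continuousD (cf x) (cg x).
- exact: continuousM (cf x) (cg x).
Qed.

Lemma elem_smooth f : elem f -> smooth f.
Proof.
move=> ef s; have {ef} : elem (foldr (@partial R n) f s).
  elim: s => // i s /= /(@elem_derive _ i)[g eg dg].
  rewrite (_ : partial _ _ = g)//; apply/funext => x.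
  by rewrite /partial; have [_ ->] := dg x.
move: (foldr _ _ _) => g eg; split; first exact: elem_continuous.
by move=> i x; have [h _ /(_ x) []] := elem_derive _ i eg.
Qed.

Lemma elem_prod (F : 'I_n -> R -> R) : (forall i, elem1 (F i)) ->
  elem (fun x => \prod_i F i (x 0 i)).
Proof.
move=> eF; elim: (index_enum _) => [|i s IH].
  by under eq_fun do rewrite big_nil; exact: elem_cst.
under eq_fun do rewrite big_cons.
by apply: elem_mul => //; exact: elem_coord.
Qed.

Definition cbox (a b : 'rV[R]_n) : set 'rV[R]_n :=
  [set x | forall i, a 0 i <= x 0 i <= b 0 i].

Definition obox (a b : 'rV[R]_n) : set 'rV[R]_n :=
  [set x | forall i, a 0 i < x 0 i < b 0 i].

Lemma cbox_bounded a b : bounded_set (cbox a b).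
Proof.
exists (`|a| + `|b|); split; first exact: num_real.
move=> M abM x xab; apply: norm_le_coord => [|i].
  by apply: le_trans (ltW abM); rewrite addr_ge0.
have := xab i; have := coord_le_norm _ a i; have := coord_le_norm _ b i.
move: (normr_ge0 a) (normr_ge0 b) abM; rewrite !ler_norml.
by move=> ? ? ? /andP[? ?] /andP[? ?] /andP[? ?]; apply/andP; split; lra.
Qed.

Lemma cbox_closed a b : closed (cbox a b).
Proof.
rewrite (_ : cbox a b = \bigcap_(i in [set: 'I_n])
    ((fun x : 'rV[R]_n => x 0 i) @^-1` `[a 0 i, b 0 i]%classic)).
  apply: closed_bigI => i _; apply: closed_comp; last exact: itv_closed.
  by move=> x _; exact: coord_continuous.
apply/seteqP; split=> x /=.
  by move=> xab i _ /=; rewrite in_itv/=; exact: xab.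
by move=> xab i; have := xab i I; rewrite /= in_itv/=.
Qed.

Lemma cbox_compact a b : compact (cbox a b).
Proof. exact: bounded_closed_compact (cbox_bounded _ _) (cbox_closed _ _). Qed.

Lemma cbox_measurable a b : measurable (cbox a b).
Proof.
rewrite -[cbox a b]setCK; apply: measurableC; apply: open_measurable_mx.
by apply: closed_openC; exact: cbox_closed.
Qed.

Lemma obox_open a b : open (obox a b).
Proof.
rewrite openE => x xab.
apply: (@filter_forall 'rV[R]_n 'I_n
  (fun j => [set y | a 0 j < y 0 j < b 0 j]) (nbhs x)) => j.
have oI : open ((fun y : 'rV[R]_n => y 0 j) @^-1` `]a 0 j, b 0 j[%classic).
  by apply: open_comp => [y _|]; [exact: coord_continuous|exact: interval_open].
have : nbhs x ((fun y : 'rV[R]_n => y 0 j) @^-1` `]a 0 j, b 0 j[%classic).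
  by apply: open_nbhs_nbhs; split => //=; rewrite in_itv/=.
by apply: filterS => y; rewrite /= in_itv.
Qed.

Lemma obox_measurable a b : measurable (obox a b).
Proof. exact: open_measurable_mx (obox_open _ _). Qed.

Lemma test_prod (O : set 'rV[R]_n) (F : 'I_n -> R -> R) (a b : 'rV[R]_n) :
  (forall i, elem1 (F i)) ->
  (forall i t, ~~ (a 0 i <= t <= b 0 i) -> F i t = 0) ->
  cbox a b `<=` O -> test_function O (fun x => \prod_i F i (x 0 i)).
Proof.
move=> eF F0 abO; have sub : closure [set x : 'rV[R]_n | \prod_i F i (x 0 i) != 0] `<=` cbox a b.
  rewrite [X in _ `<=` X](closure_id _).1; last exact: cbox_closed.
  apply: closureS.
  move=> x /= H i; apply/negPn/negP => /F0 Fi0; move/negP: H; apply.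
  by apply/prodf_eq0; exists i => //; rewrite Fi0.
split.
- exact/elem_smooth/elem_prod.
- apply: subclosed_compact sub; [exact: closed_closure|exact: cbox_compact].
- exact: subset_trans abO.
Qed.

(** Smooth approximation from below of the indicator of the open interval from [a] to [b]: larger
    [k] means steeper flanks, with unchanged support. The arguments of [flat] are spelled in the
    affine form of [elem1_flat]; [bumpE] gives the readable form. *)
Definition bump (k : nat) (a b : R) (t : R) :=
  flat 0 (k.+1%:R * t + - (k.+1%:R * a)) * flat 0 (- k.+1%:R * t + k.+1%:R * b).

Lemma elem1_bump k a b : elem1 (bump k a b).
Proof. by apply: elem1_mul; exact: elem1_flat. Qed.

Lemma bump_ge0 k a b t : 0 <= bump k a b t.
Proof. by rewrite mulr_ge0// flat_ge0. Qed.

Lemma bump_le1 k a b t : bump k a b t <= 1.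
Proof. by rewrite mulr_ile1 ?flat_ge0 ?flat0_le1. Qed.

Lemma flat0_cvg (t : R) : flat 0 (k.+1%:R * t) @[k --> \oo] --> ((0 < t)%R%:R : R).
Proof.
have [t0|t0] := leP t 0.
  under eq_fun do rewrite flat_le0 ?mulr_ge0_le0//.
  exact: cvg_cst.
rewrite /flat.
under eq_fun do rewrite pmulr_rgt0// t0 expr0 mul1r invfM.
have H : - (k.+1%:R^-1 * t^-1) @[k --> \oo] --> - (0 * t^-1 : R).
  by apply: cvgN; apply: cvgM; [exact: cvg_harmonic|exact: cvg_cst].
rewrite mul0r oppr0 in H; rewrite (_ : true%:R = expR 0 :> R); last by rewrite expR0.
exact: (continuous_cvg _ (@continuous_expR R 0) H).
Qed.

Lemma bumpE k a b t :
  bump k a b t = flat 0 (k.+1%:R * (t - a)) * flat 0 (k.+1%:R * (b - t)).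
Proof. by rewrite /bump; congr (flat 0 _ * flat 0 _); ring. Qed.

Lemma bump_cvg a b t : bump k a b t @[k --> \oo] --> ((a < t < b)%R%:R : R).
Proof.
rewrite (_ : (_ < _ < _)%R%:R = (0 < t - a)%R%:R * (0 < b - t)%R%:R :> R); last first.
  by rewrite !subr_gt0 -natrM mulnb.
under eq_fun do rewrite bumpE.
by apply: cvgM; exact: flat0_cvg.
Qed.

Lemma bump_eq0 k a b t : ~~ (a < t < b) -> bump k a b t = 0.
Proof.
rewrite negb_and -!leNgt bumpE => /orP[ta|bt].
  by rewrite flat_le0 ?mul0r// mulr_ge0_le0// subr_le0.
by rewrite [X in _ * X]flat_le0 ?mulr0// mulr_ge0_le0// subr_le0.
Qed.

End smooth_functions.

(** * A function orthogonal to all box bumps vanishes almost everywhere *)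

Section ae_zero.
Context {R : realType} {n : nat}.
Local Notation Rn := 'rV[R]_n.
Local Notation mu := (vol R n).

Lemma open_lt_fun (f : Rn -> R) r : continuous f -> open [set x | f x < r].
Proof.
move=> cf; rewrite (_ : [set _ | _] = f @^-1` `]-oo, r[%classic).
  by apply: open_comp => [x _|]; [exact: cf|exact: interval_open].
by apply/seteqP; split => x /=; rewrite in_itv.
Qed.

Lemma open_gt_fun (f : Rn -> R) r : continuous f -> open [set x | r < f x].
Proof.
move=> cf; rewrite (_ : [set _ | _] = f @^-1` `]r, +oo[%classic).
  by apply: open_comp => [x _|]; [exact: cf|exact: interval_open].
by apply/seteqP; split => x /=; rewrite in_itv/= andbT.
Qed.

Lemma continuous_measurable_mx (f : Rn -> R) : continuous f ->
  measurable_fun [set: Rn] f.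
Proof.
move=> cf; apply: (measurability _ (RGenOpens.measurableE R)).
move=> _ [_ [a [b ->] <-]]; rewrite setTI; apply: open_measurable_mx.
by move/continuousP : cf; apply; exact: interval_open.
Qed.

Lemma cvg_prodr (I : Type) (s : seq I) (u : I -> nat -> R) (l : I -> R) :
  (forall i, u i k @[k --> \oo] --> l i) ->
  \prod_(i <- s) u i k @[k --> \oo] --> \prod_(i <- s) l i.
Proof.
move=> ul; elim: s => [|i s IH].
  by under eq_fun do rewrite big_nil; rewrite big_nil; exact: cvg_cst.
under eq_fun do rewrite big_cons; rewrite big_cons.
by apply: cvgM.
Qed.

Definition boxbump k (a b : Rn) (x : Rn) : R :=
  \prod_i bump k (a 0 i) (b 0 i) (x 0 i).

Lemma boxbump_continuous k a b : continuous (boxbump k a b).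
Proof.
apply: elem_continuous; apply: (elem_prod (fun i => bump k (a 0 i) (b 0 i))) => i.
exact: elem1_bump.
Qed.

Lemma boxbump_ge0 k a b x : 0 <= boxbump k a b x.
Proof. by apply: prodr_ge0 => i _; exact: bump_ge0. Qed.

Lemma boxbump_le1 k a b x : boxbump k a b x <= 1.
Proof. by apply: prodr_ile1 => i _; rewrite bump_ge0 bump_le1. Qed.

Lemma boxbump_eq0 k a b x : ~ cbox a b x -> boxbump k a b x = 0.
Proof.
move=> H; apply/eqP/negPn/negP => /prodf_neq0 H'; apply: H => i.
have := H' i isT; apply: contraNT => H; rewrite bump_eq0//.
by apply: contra H => /andP[/ltW -> /ltW ->].
Qed.

Lemma test_boxbump (O : set Rn) k a b : cbox a b `<=` O ->
  test_function O (boxbump k a b).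
Proof.
apply: (test_prod _ (fun i => bump k (a 0 i) (b 0 i))) => [i|i t H]; first exact: elem1_bump.
by rewrite bump_eq0//; apply: contra H => /andP[/ltW -> /ltW ->].
Qed.

Lemma boxbump_cvg a b x : boxbump k a b x @[k --> \oo] --> (\1_(obox a b) x : R).
Proof.
rewrite (_ : \1_(obox a b) x = \prod_i (a 0 i < x 0 i < b 0 i)%R%:R :> R).
  by apply: cvg_prodr => i; exact: bump_cvg.
rewrite indicE; case: (boolP (x \in _)) => [|/negP xab].
  by rewrite inE => xab; rewrite big1// => i _; rewrite xab.
apply/esym/eqP/prodf_eq0.
have [i xi] : exists i, ~~ (a 0 i < x 0 i < b 0 i).
  apply: contra_notP xab => /forallNP H; rewrite inE => i.
  by have /negP := H i; rewrite negbK.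
by exists i => //; rewrite (negbTE xi).
Qed.

Lemma integrable_mulr_bounded (D : set Rn) (f g : Rn -> R) (C : R) : measurable D ->
  mu.-integrable D (EFin \o f) -> measurable_fun D g ->
  (forall x, D x -> `|g x| <= C) ->
  mu.-integrable D (fun x => (f x * g x)%:E).
Proof.
move=> mD fi mg gC.
have [/seteqP[D0 _]|/set0P[x0 Dx0]] := eqVneq D set0.
  by rewrite (_ : D = set0) ?integrable_set0//; apply/seteqP; split.
have C0 : 0 <= C by exact: le_trans (normr_ge0 _) (gC _ Dx0).
apply: (@le_integrable _ _ _ mu D mD _ (fun x => (C * f x)%:E)).
- apply/measurable_EFinP; apply: measurable_funM => //.
  by have /measurable_int/measurable_EFinP := fi.
- move=> x Dx; rewrite /= lee_fin !normrM (ger0_norm C0) mulrC.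
  by rewrite ler_wpM2r// gC.
- under eq_fun do rewrite EFinM.
  exact: integrableZl.
Qed.

(** The bumps converge pointwise to the indicator of the open box, and |f| on the closed box
    dominates the products, so dominated convergence applies. *)
Lemma integral_obox_eq0 (O : set Rn) (f : Rn -> R) (a b : Rn) : measurable O ->
  mu.-integrable (cbox a b) (EFin \o f) -> cbox a b `<=` O ->
  (forall k, \int[mu]_(x in O) (f x * boxbump k a b x) = 0) ->
  (\int[mu]_(x in obox a b) (f x)%:E = 0)%E.
Proof.
move=> mO fi abO f0.
have mf : measurable_fun (cbox a b) f.
  by have /measurable_int/measurable_EFinP := fi.
have mD := cbox_measurable a b.
have mb k : measurable_fun (cbox a b) (boxbump k a b).
  apply: measurable_funTS; apply: continuous_measurable_mx.
  exact: boxbump_continuous.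
have gi k : mu.-integrable (cbox a b) (fun x => (f x * boxbump k a b x)%:E).
  apply: (integrable_mulr_bounded _ _ _ 1) => // x _.
  by rewrite ger0_norm ?boxbump_ge0 ?boxbump_le1.
have Ik k : (\int[mu]_(x in cbox a b) (f x * boxbump k a b x)%:E = 0)%E.
  (* The real-valued integral is [fine] of the extended one and would also be 0 for an infinite
     value; integrability of the product excludes this. *)
  have := f0 k; rewrite /Rintegral.
  rewrite (_ : integral _ O _ = \int[mu]_(x in cbox a b) (f x * boxbump k a b x)%:E)%E.
    by move=> /eqP; rewrite fine_eq0 ?(integrable_fin_num _ (gi k))// => /eqP.
  rewrite -[in RHS](setIidr abO) integral_mkcondr.
  apply: eq_integral => x _; rewrite patchE; case: ifPn => // /negP; rewrite inE => H.
  by rewrite boxbump_eq0// mulr0.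
have [|||||_ _] := @dominated_convergence _ _ _ mu _ mD
  (fun k x => (f x * boxbump k a b x)%:E) (fun x => (f x * \1_(obox a b) x)%:E)
  (fun x => `|(f x)%:E|%E).
- by move=> k; apply/measurable_EFinP; exact: measurable_funM.
- apply/measurable_EFinP; apply: measurable_funM => //.
  by apply: measurable_indic; exact: obox_measurable.
- apply: aeW => x _; apply: cvg_EFin; first exact: nearW.
  by apply: cvgM; [exact: cvg_cst|exact: boxbump_cvg].
- exact: integrable_abse.
- apply: aeW => x k _; rewrite /= lee_fin normrM.
  by rewrite ler_piMr// ger0_norm ?boxbump_ge0 ?boxbump_le1.
under eq_fun do rewrite Ik.
move=> /cvg_lim; rewrite lim_cst// => H.
have oc : obox a b `<=` cbox a b by move=> x H' i; have /andP[/ltW -> /ltW ->] := H' i.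
rewrite -(setIidr oc) integral_mkcondr [RHS]H//.
apply: eq_integral => x _; rewrite patchE indicE.
by case: ifP => _; rewrite ?mulr1 ?mulr0.
Qed.

End ae_zero.

(** * From vanishing integrals over boxes to vanishing almost everywhere *)

Section ae_zero_dynkin.
Context {R : realType} {n : nat}.
Local Notation Rn := 'rV[R]_n.
Local Notation mu := (vol R n).

Lemma obox_setI (a b c d : Rn) : obox a b `&` obox c d =
  obox (\row_i Num.max (a 0 i) (c 0 i)) (\row_i Num.min (b 0 i) (d 0 i)).
Proof.
apply/seteqP; split => x /=.
  move=> [xab xcd] i; rewrite !mxE gt_max lt_min.
  by case/andP: (xab i) => -> ->; case/andP: (xcd i) => -> ->.
move=> H; split => i; have := H i;
  by rewrite !mxE gt_max lt_min => /andP[/andP[? ?] /andP[? ?]]; apply/andP.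
Qed.

Lemma ball_obox (x : Rn) (e : R) : 0 < e ->
  ball x e = obox (x - const_mx e) (x + const_mx e).
Proof.
move=> e0; apply/seteqP; split => y /=.
  move=> [_ xy] i; have := xy 0 i; rewrite /ball/= !mxE distrC ltr_distl.
  by [].
move=> xy; split => // i j; rewrite (ord1 i) /ball/= distrC ltr_distl.
by have := xy j; rewrite !mxE /=.
Qed.

(** Balls of the sup norm are open boxes, and every open set is a countable union of rational ones;
    [pickle] turns the index type into the natural numbers. *)
Lemma measurable_obox_gen :
  @measurable _ Rn = <<s [set A | exists a b, A = obox a b] >>.
Proof.
apply/seteqP; split.
  have sa : sigma_algebra setT <<s [set A : set Rn | exists a b, A = obox a b] >>.
    exact: smallest_sigma_algebra.
  apply: smallest_sub => // U oU.
  rewrite (open_bigcup_rat_box oU).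
  pose F (k : nat) : set Rn := if unpickle k is Some b then
    (if `[< @rat_box R 1 n b `<=` U >] then @rat_box R 1 n b else set0) else set0.
  rewrite (_ : \bigcup_b _ = \bigcup_k F k).
    case: sa => sa0 saC saU; apply: saU => k; rewrite /F.
    case: unpickle => [b|]; last exact: sa0.
    case: asboolP => _; last exact: sa0.
    apply: sub_sigma_algebra; rewrite /rat_box ball_obox ?invr_gt0//.
    by eexists; eexists.
  apply/seteqP; split => [x [b _ xb]|x [k _]].
    by exists (pickle b) => //; rewrite /F pickleK.
  by rewrite /F; case: unpickle => // b xb; exists b.
apply: smallest_sub; first exact: sigma_algebra_measurable.
by move=> _ [a [b ->]]; exact: obox_measurable.
Qed.

(** Dynkin's lemma: open boxes are stable under intersection and generate the Borel sets, while the
    sets on which the truncated [f] has integral 0 are stable under complement and disjoint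
    countable union. A function whose integral vanishes over every Borel set is null. *)
Lemma ae_eq0_obox (a b : Rn) (f : Rn -> R) :
  mu.-integrable (obox a b) (EFin \o f) ->
  (forall c d, cbox c d `<=` cbox a b ->
    \int[mu]_(x in obox c d) (f x)%:E = 0)%E ->
  {ae mu, forall x, obox a b x -> f x = 0}.
Proof.
move=> fi f0.
have mD := obox_measurable a b.
set h := (EFin \o f) \_ (obox a b).
have hi : mu.-integrable setT h by have := (integrable_mkcond _ mD).1 fi.
have h0 S : measurable S -> (\int[mu]_(x in S) h x = 0)%E.
  rewrite [X in X _ -> _]measurable_obox_gen.
  move: S; apply: (@dynkin_induction _ 'rV[R]_n
    [set A | exists a b, A = obox a b] (fun S => \int[mu]_(x in S) h x = 0)%E).
  - exact: measurable_obox_gen.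
  - move=> _ _ [c [d ->]] [c' [d' ->]]; rewrite obox_setI.
    by eexists; eexists.
  - by rewrite -integral_mkcond; exact: (f0 _ _ (@subset_refl _ _)).
  - move=> _ [c [d ->]] /=; rewrite -integral_mkcondr setIC obox_setI; apply: f0.
    by move=> x H i; have := H i; rewrite !mxE ge_max le_min => /andP[/andP[? _] /andP[? _]]; apply/andP.
  - move=> S mS S0; have mSC := measurableC mS.
    have : (\int[mu]_(x in setT) h x = 0)%E.
      by rewrite -integral_mkcond; exact: (f0 _ _ (@subset_refl _ _)).
    rewrite -(setUv S) integral_setU//.
    + by rewrite S0 add0e.
    + rewrite setUv; exact: (measurable_int _ hi).
    + by apply/disj_setPS; rewrite setICr.
  - move=> F mF tF F0; rewrite integral_bigcup//.
      by apply: eseries0 => k _ _; exact: F0.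
    apply: integrableS hi => //; exact: bigcup_measurable.
have : ae_eq mu setT h (cst 0%E).
  apply: integral_ae_eq => //.
  by move=> E _ mE; rewrite h0// integral0.
apply: filterS => x /(_ I) + xab.
by rewrite /h patchE mem_set//= => -[].
Qed.

Lemma ae_countable (T : countType) (P : T -> Rn -> Prop) :
  (forall b, {ae mu, forall x, P b x}) -> {ae mu, forall x, forall b, P b x}.
Proof.
move=> H.
pose F (k : nat) : set Rn := if unpickle k is Some b then ~` [set x | P b x] else set0.
apply: (@negligibleS _ _ _ mu (\bigcup_k F k)).
  move=> x /= /existsNP[b xb]; exists (pickle b) => //.
  by rewrite /F pickleK.
apply: negligible_bigcup => k; rewrite /F.
by case: unpickle => [b|]; [exact: H|exact: negligible_set0].
Qed.

(** The fundamental lemma of the calculus of variations, tested on box bumps only. It is applied on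
    the countably many rational boxes whose closure lies in [O], where [f] is integrable. *)
Lemma ae_eq0_of_boxbump (O : set Rn) (f : Rn -> R) : open O ->
  loc_integrable O f ->
  (forall k a b, cbox a b `<=` O ->
    \int[mu]_(x in O) (f x * boxbump k a b x) = 0) ->
  {ae mu, forall x, O x -> f x = 0}.
Proof.
move=> oO [mf fi] H.
pose lo (b : 'M[rat]_(1, n) * nat) : Rn := map_mx ratr b.1 - const_mx b.2.+1%:R^-1.
pose hi (b : 'M[rat]_(1, n) * nat) : Rn := map_mx ratr b.1 + const_mx b.2.+1%:R^-1.
have : {ae mu, forall x, forall b, cbox (lo b) (hi b) `<=` O ->
    obox (lo b) (hi b) x -> f x = 0}.
  apply: ae_countable => b.
  have [bO|bO] := pselect (cbox (lo b) (hi b) `<=` O); last by apply: aeW => x /bO.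
  have fib := fi _ (cbox_compact _ _) bO.
  have := @ae_eq0_obox (lo b) (hi b) f.
  have oc : obox (lo b) (hi b) `<=` cbox (lo b) (hi b).
    by move=> x H' i; have /andP[/ltW -> /ltW ->] := H' i.
  move=> /(_ (integrableS _ _ oc fib)) H'.
  have {H'} : {ae mu, forall x, obox (lo b) (hi b) x -> f x = 0}.
    apply: H'; [exact: cbox_measurable|exact: obox_measurable|].
    move=> c d cb; have cO := subset_trans cb bO.
    apply: (integral_obox_eq0 _ _ _ _ (open_measurable_mx oO) _ cO) => [|k].
      by apply: fi => //; exact: cbox_compact.
    exact: H.
  by apply: filterS => x + _.
apply: filterS => x Hx Ox.
have /nbhs_ballP[e /= e0 eO] : nbhs x O by exact: open_nbhs_nbhs.
(* The box has radius 1/(k+1) and its rational center is within 1/(k+1) of [x], so each coordinate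
   of a point of the closed box is within 2/(k+1) < e/2 of that of [x]. *)
have [k kM] : exists k, k.+1%:R^-1 < e / 4 by apply: exists_invS_lt; rewrite divr_gt0.
have k0 : 0 < k.+1%:R^-1 :> R by rewrite invr_gt0.
have ratP j : exists q : rat,
    x 0 j - k.+1%:R^-1 < ratr q < x 0 j + k.+1%:R^-1.
  have [|q] := @rat_in_itvoo R (x 0 j - k.+1%:R^-1) (x 0 j + k.+1%:R^-1).
    by rewrite ltrBlDr -addrA ltrDl addr_gt0.
  by rewrite in_itv; exists q.
pose b := (\matrix_(i < 1, j < n) sval (cid (ratP j)), k).
apply: (Hx b).
  move=> y xy; apply: eO; split => // i j; rewrite (ord1 i) {i} /ball/=.
  have := xy j; rewrite !mxE /=.
  case: cid => q /= /andP[q1 q2] /andP[y1 y2].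
  move: (k.+1%:R^-1) kM k0 q1 q2 y1 y2 => r *.
  by rewrite distrC ltr_distl; apply/andP; split; lra.
move=> j; rewrite !mxE /=; case: cid => q /= /andP[q1 q2].
move: (k.+1%:R^-1) q1 q2 => r *; by apply/andP; split; lra.
Qed.

End ae_zero_dynkin.

(** * Continuously differentiable functions are Sobolev functions *)

Section c1_functions.
Context {R : realType} {n : nat}.
Local Notation Rn := 'rV[R]_n.
Local Notation mu := (vol R n).

Lemma integrable_cst_vol (D : set Rn) (C : R) : measurable D -> (mu D < +oo)%E ->
  mu.-integrable D (cst C%:E).
Proof.
move=> mD Doo; apply/integrableP; split; first exact: measurable_cst.
rewrite (_ : (fun x => _) = cst `|C|%:E); last exact/funext.
by rewrite integral_cst// lte_mul_pinfty// ?lee_fin// ge0_fin_numE.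
Qed.

Lemma compact_measurable (K : set Rn) : compact K -> measurable K.
Proof.
move=> cK; rewrite -[K]setCK; apply: measurableC; apply: open_measurable_mx.
by apply: closed_openC; apply: compact_closed => //; exact: norm_hausdorff.
Qed.

Lemma bounded_closure_compact (A : set Rn) : bounded_set A -> compact (closure A).
Proof.
move=> [M [Mr HM]]; apply: bounded_closed_compact; last exact: closed_closure.
exists (M + 1); split; first by rewrite realD// real1.
move=> N MN x xA; apply/ler_addgt0Pr => d d0.
have [y [yA xy]] := xA _ (nbhsx_ballx x d d0).
have := HM N; rewrite (lt_trans _ MN) ?ltrDl// => /(_ isT y yA) /= yN.
rewrite -(subrK y x) addrC (le_trans (ler_normD _ _))// lerD//.
by move: xy; rewrite -ball_normE /= => /ltW.
Qed.

Lemma continuous_bounded_compact (K : set Rn) (f : Rn -> R) : compact K ->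
  continuous f -> exists2 C, 0 <= C & forall x, K x -> `|f x| <= C.
Proof.
move=> cK cf; have /compact_bounded[M [_ HM]] : compact (f @` K).
  by apply: continuous_compact => //; exact: continuous_subspaceT.
exists (`|M| + 1); first by rewrite addr_ge0.
move=> x Kx; apply: HM; last by exists x.
by rewrite (le_lt_trans (ler_norm _))// ltrDl.
Qed.

Lemma integrable_continuous_compact (K : set Rn) (f : Rn -> R) : compact K ->
  continuous f -> mu.-integrable K (EFin \o f).
Proof.
move=> cK cf; have mK := compact_measurable _ cK.
have [C C0 fC] := continuous_bounded_compact _ _ cK cf.
apply: (@le_integrable _ _ _ mu K mK _ (cst C%:E)).
- by apply/measurable_EFinP/measurable_funTS; exact: continuous_measurable_mx.
- by move=> x Kx; rewrite /= lee_fin (ger0_norm C0) fC.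
- apply: integrable_cst_vol => //.
  by apply: vol_bounded => //; exact: compact_bounded.
Qed.

Lemma integrable_csupp (O K : set Rn) (f : Rn -> R) : measurable O -> compact K ->
  K `<=` O -> (forall x, ~ K x -> f x = 0) -> mu.-integrable K (EFin \o f) ->
  mu.-integrable O (EFin \o f).
Proof.
move=> mO cK KO f0 fi; have mK := compact_measurable _ cK.
apply: (integrableS measurableT mO (@subsetT _ _)).
rewrite (_ : EFin \o f = (EFin \o f) \_ K).
  by have := (integrable_mkcond _ mK).1 fi.
apply/funext => x; rewrite patchE; case: ifPn => // /negP; rewrite inE => /f0 /= ->.
by [].
Qed.

Lemma Rintegral_csupp (O K : set Rn) (f : Rn -> R) : K `<=` O ->
  (forall x, ~ K x -> f x = 0) ->
  \int[mu]_(x in O) f x = \int[mu]_x f x.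
Proof.
move=> KO f0; rewrite Rintegral_mkcond; congr fine; apply: eq_integral => x _.
rewrite patchE; case: ifPn => // /negP; rewrite inE => Ox.
by rewrite f0// => /KO.
Qed.

Lemma integrable_mul_csupp (O K : set Rn) (f g : Rn -> R) : measurable O ->
  loc_integrable O f -> compact K -> K `<=` O -> continuous g ->
  (forall x, ~ K x -> g x = 0) -> mu.-integrable O (fun x => (f x * g x)%:E).
Proof.
move=> mO [mf fi] cK KO cg g0; have mK := compact_measurable _ cK.
have [C C0 gC] := continuous_bounded_compact _ _ cK cg.
apply: (integrable_csupp _ K) => //; first by move=> x /g0 ->; rewrite mulr0.
apply: (integrable_mulr_bounded _ _ _ C) => //; first exact: fi.
by apply: measurable_funTS; exact: continuous_measurable_mx.
Qed.

(** By translation invariance every difference quotient of [f] along [v] has integral 0. The mean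
    value theorem bounds them all by sup |g|, and dominated convergence passes to the limit [g]. *)
Lemma integral_derivative_csupp (K : set Rn) (f g : Rn -> R) (v : Rn) : compact K ->
  continuous f -> continuous g -> (forall x, is_derive x v f (g x)) ->
  (forall x, ~ K x -> f x = 0) -> (forall x, ~ K x -> g x = 0) ->
  \int[mu]_x g x = 0.
Proof.
move=> cK cf cg df f0 g0.
have [C C0 gC] := continuous_bounded_compact _ _ cK cg.
have {}gC x : `|g x| <= C.
  by have [/gC//|/g0 ->] := pselect (K x); rewrite normr0.
pose h k : R := k.+1%:R^-1.
have h0 k : 0 < h k by rewrite invr_gt0.
have h1 k : h k <= 1 by rewrite invf_le1// ler1n.
pose q k x := (h k)^-1 * (f (x + h k *: v) - f x).
have fi : mu.-integrable setT (EFin \o f).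
  by apply: (integrable_csupp _ K) => //; exact: integrable_continuous_compact.
have qi k : (\int[mu]_x (q k x)%:E = 0)%E.
  have ti := integrable_translate _ (h k *: v) _ (measurable_int _ fi) fi.
  under eq_integral do rewrite EFinM EFinB.
  rewrite integralZl//; last exact: integrableB.
  rewrite integralB// (integral_translate _ _ (EFin \o f) fi) subee ?mule0//.
  exact: integrable_fin_num.
have qC k x : `|q k x| <= C.
  have ct : continuous (fun t : R => f (t *: v + x)).
    move=> t; apply: (@continuous_comp _ _ _ (fun t : R => t *: v + x) f); last exact: cf.
    by apply: cvgD; [exact: scalel_continuous|exact: cvg_cst].
  have [t _ E] := @MVT R (fun t => f (t *: v + x)) (fun t => g (t *: v + x)) 0 (h k)
    (h0 k) (fun t _ => is_derive_line _ _ _ _ _ _ (df (t *: v + x))) (continuous_subspaceT ct).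
  rewrite /q (addrC x); move: E; rewrite scale0r add0r subr0 => ->.
  by rewrite mulrC mulfK ?gt_eqF.
have [M [_ HM]] := compact_bounded cK.
(* The cube of half-side [r] contains [K] enlarged by |v|; since [h k <= 1], it carries all the
   quotients at once, which yields a common integrable majorant. *)
pose r := `|M| + 1 + `|v|.
have r0 : 0 <= r by rewrite !addr_ge0.
pose K' := cbox (const_mx (- r)) (const_mx r : Rn).
have KM x : K x -> `|x| <= `|M| + 1.
  by apply: HM; rewrite (le_lt_trans (ler_norm _))// ltrDl.
have K'0 k x : ~ K' x -> q k x = 0.
  move=> K'x; have [Kx|/f0 fx] := pselect (K x).
    exfalso; apply: K'x => i; rewrite !mxE -ler_norml.
    apply: le_trans (coord_le_norm _ x i) _.
    by rewrite (le_trans (KM _ Kx))// lerDl.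
  have [Kx|/f0 fx'] := pselect (K (x + h k *: v)); last by rewrite /q fx fx' subr0 mulr0.
  exfalso; apply: K'x => i; rewrite !mxE -ler_norml.
  apply: le_trans (coord_le_norm _ x i) _.
  rewrite -(addrK (h k *: v) x) (le_trans (ler_normB _ _))// lerD ?KM//.
  by rewrite normrZ (gtr0_norm (h0 k)) ler_piMl.
have mK' : measurable K' by exact: cbox_measurable.
have mq k : measurable_fun setT (q k).
  apply: measurable_funM => //; apply: measurable_funB; last exact: continuous_measurable_mx.
  apply: (measurableT_comp (continuous_measurable_mx _ cf)).
  exact: measurable_addmx.
have [|||||_ _] := @dominated_convergence _ _ _ mu _ measurableT
  (fun k x => (q k x)%:E) (fun x => (g x)%:E) (fun x => (C * \1_K' x)%:E).
- by move=> k; exact/measurable_EFinP.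
- by apply/measurable_EFinP; exact: continuous_measurable_mx.
- apply: aeW => x _; apply: cvg_EFin; first exact: nearW.
  have [dx dE] := df x.
  have dc : t^-1 * (f (x + t *: v) - f x) @[t --> 0^'] --> g x.
    by under eq_fun do rewrite (addrC x); rewrite -dE; exact: dx.
  apply: ((cvgr_dnbhsP _ _ _).1 dc h); split; first by move=> k; rewrite gt_eqF.
  exact: cvg_harmonic.
- rewrite (_ : (fun x => _) = (cst C%:E) \_ K').
    apply/(integrable_mkcond _ mK'); apply: integrable_cst_vol => //.
    by apply: vol_bounded => //; exact: cbox_bounded.
  apply/funext => x; rewrite patchE indicE.
  by case: ifP => _; rewrite ?mulr1 ?mulr0.
- apply: aeW => x k _; rewrite /= lee_fin indicE.
  case: (boolP (x \in K')) => [_|/negP]; first by rewrite mulr1.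
  by rewrite inE => /K'0 ->; rewrite normr0 mulr0.
under eq_fun do rewrite qi.
by move=> /cvg_lim; rewrite lim_cst// /Rintegral => <-.
Qed.

End c1_functions.

Section c1_sobolev.
Context {R : realType} {n : nat}.
Local Notation Rn := 'rV[R]_n.
Local Notation mu := (vol R n).

Definition has_grad (u : Rn -> R) (G : 'I_n -> Rn -> R) :=
  [/\ continuous u, forall i, continuous (G i) &
      forall x i, is_derive x (delta_mx 0 i) u (G i x)].

Lemma loc_integrable_continuous (O : set Rn) (u : Rn -> R) : continuous u ->
  loc_integrable O u.
Proof.
move=> cu; split; first by apply: measurable_funTS; exact: continuous_measurable_mx.
by move=> K cK _; exact: integrable_continuous_compact.
Qed.

(** The product of [u] with a test function is C^1 with compact support, so its i-th derivative
    integrates to 0; the product rule turns this into integration by parts. *)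
Lemma weak_gradient_C1 (O : set Rn) (u : Rn -> R) G : open O -> has_grad u G ->
  weak_gradient O u (fun x => \row_i G i x).
Proof.
move=> oO [cu cG du]; have mO := open_measurable_mx oO; split.
- exact: loc_integrable_continuous.
- move=> i; under eq_fun do rewrite mxE.
  exact: loc_integrable_continuous.
- move=> phi i [sphi]; set K := closure _ => cK KO.
  have cphi : continuous phi by have [] := sphi [::].
  have cdphi : continuous (partial i phi) by have [] := sphi [:: i].
  have phi0 x : ~ K x -> phi x = 0.
    by move=> Kx; apply/eqP/negPn/negP => H; apply: Kx; exact: subset_closure.
  have dphi0 x : ~ K x -> partial i phi x = 0.
    move=> Kx; rewrite /partial (@near_eq_derive R 'rV[R]_n R^o phi (cst 0)) ?derive_cst//.
    have : nbhs x (~` K) by apply: open_nbhs_nbhs; split => //; exact/closed_openC/closed_closure.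
    by apply: filterS => y /phi0.
  have dphi x : is_derive x (delta_mx 0 i) phi (partial i phi x).
    by have [_ H] := sphi [::]; apply: DeriveDef => //; exact: H.
  under [in RHS]eq_Rintegral do rewrite mxE.
  have Z : \int[mu]_x (u x * partial i phi x + phi x * G i x) = 0.
    apply: (integral_derivative_csupp K (fun x => u x * phi x)
      (fun x => u x * partial i phi x + phi x * G i x) (delta_mx 0 i)) => //.
    - by move=> x; exact: continuousM (cu x) (cphi x).
    - by move=> x; exact: continuousD (continuousM (cu x) (cdphi x)) (continuousM (cphi x) (cG i x)).
    - by move=> x /phi0 ->; rewrite mulr0.
    - by move=> x Kx; rewrite phi0// dphi0// mulr0 mul0r addr0.
  rewrite -(Rintegral_csupp O K) in Z => //; last first.
    by move=> x Kx; rewrite phi0// dphi0// mulr0 mul0r addr0.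
  apply/eqP; rewrite -addr_eq0 -[X in _ == X]Z RintegralD//.
  + under [X in _ + X == _]eq_Rintegral do rewrite mulrC.
    by [].
  + by apply: (integrable_mul_csupp _ K) => //; exact: loc_integrable_continuous.
  + by apply: (integrable_csupp _ K) => //; [move=> x Kx; rewrite phi0// mul0r|
     apply: integrable_continuous_compact => // x; apply: continuousM; [exact: cphi|exact: cG]].
Qed.

(** Each component of the difference is orthogonal to all box bumps. This carries bounds on an
    explicit gradient over to the one selected by [grad]. *)
Lemma weak_gradient_unique (O : set Rn) (u : Rn -> R) (g h : Rn -> Rn) : open O ->
  weak_gradient O u g -> weak_gradient O u h ->
  {ae mu, forall x, O x -> g x = h x}.
Proof.
move=> oO [_ lg Hg] [_ lh Hh]; have mO := open_measurable_mx oO.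
have H i : {ae mu, forall x, O x -> g x 0 i - h x 0 i = 0}.
  apply: ae_eq0_of_boxbump => //.
    split; first by apply: measurable_funB; [exact: (lg i).1|exact: (lh i).1].
    move=> K cK KO; have mK := compact_measurable _ cK.
    have := integrableB mK ((lg i).2 _ cK KO) ((lh i).2 _ cK KO).
    by [].
  move=> k a b abO.
  have I f : loc_integrable O f -> mu.-integrable O (fun x => (f x * boxbump k a b x)%:E).
    move=> lf; apply: (integrable_mul_csupp _ (cbox a b)) => //.
    - exact: cbox_compact.
    - exact: boxbump_continuous.
    - by move=> x; exact: boxbump_eq0.
  under eq_Rintegral do rewrite mulrBl.
  rewrite RintegralB//; [|exact: (I (fun x => g x 0 i))|exact: (I (fun x => h x 0 i))].
  have tb := test_boxbump _ k _ _ abO.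
  have := Hh _ i tb; rewrite (Hg _ i tb) => /oppr_inj ->.
  by rewrite subrr.
have := @ae_countable _ _ 'I_n (fun i x => O x -> g x 0 i - h x 0 i = 0) H.
apply: filterS => x Hx Ox; apply/rowP => i; apply/eqP.
by rewrite -subr_eq0 Hx.
Qed.

Lemma enormE (x : Rn) : enorm x ^+ 2 = \sum_(i < n) x 0 i ^+ 2.
Proof. by rewrite sqr_sqrtr// sumr_ge0// => i _; exact: sqr_ge0. Qed.

Lemma enorm_ge0 (x : Rn) : 0 <= enorm x.
Proof. exact: sqrtr_ge0. Qed.

Lemma coord_le_enorm (x : Rn) i : `|x 0 i| <= enorm x.
Proof.
rewrite -ler_sqr ?nnegrE ?enorm_ge0// enormE real_normK ?num_real//.
by rewrite (bigD1 i)//= lerDl sumr_ge0// => j _; exact: sqr_ge0.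
Qed.

Lemma enorm_le (x : Rn) r : 0 <= r -> (forall i, `|x 0 i| <= r) ->
  enorm x <= n%:R * r.
Proof.
move=> r0 xr; have nr0 : 0 <= n%:R * r by rewrite mulr_ge0.
rewrite -ler_sqr ?nnegrE ?enorm_ge0// enormE.
apply: (@le_trans _ _ (\sum_(i < n) r ^+ 2)).
  by apply: ler_sum => i _; rewrite -[leLHS]real_normK ?num_real// ler_sqr ?nnegrE.
rewrite sumr_const card_ord -(mulr_natl (r ^+ 2) n) exprMn ler_wpM2r ?sqr_ge0//.
by rewrite -natrX ler_nat; case: (n) => // k; rewrite expnS leq_pmulr// expn_gt0.
Qed.

Lemma measurable_enorm (D : set Rn) (g : Rn -> Rn) : measurable D ->
  (forall i, measurable_fun D (fun x => g x 0 i)) ->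
  measurable_fun D (fun x => enorm (g x)).
Proof.
move=> mD mg; rewrite /enorm.
apply: (@measurableT_comp _ _ _ _ _ _ (fun t : R => Num.sqrt t)).
  by apply: continuous_measurable_fun; exact: sqrt_continuous.
apply: measurable_sum => i; exact: measurable_funX.
Qed.

(** Pointwise, |f|^p is at most M^p on [A] plus m^p on all of [O]; the overlap does no harm and
    spares a decomposition of [O]. *)
Lemma Lp_norm_le (O A : set Rn) (p M m : R) (f : Rn -> R) :
  measurable O -> measurable A -> 0 < p -> 0 <= M -> 0 <= m ->
  measurable_fun O f ->
  {ae mu, forall x, O x -> `|f x| <= if x \in A then M else m} ->
  (Lp_norm O p f <=
    ((M `^ p)%:E * mu A + (m `^ p)%:E * mu O) `^ p^-1)%E.
Proof.
move=> mO mA p0 M0 m0 mf fb.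
rewrite /Lp_norm unlock gt0_ler_poweR//.
- by rewrite invr_ge0 ltW.
- by rewrite in_itv/= integral_ge0//= leey.
- by rewrite in_itv/= leey andbT adde_ge0// mule_ge0// lee_fin powR_ge0.
have mr : measurable_fun setT (f \_ O) by have := (measurable_restrictT f mO).1 mf.
apply: (@le_trans _ _ (\int[mu]_x ((M `^ p)%:E * (\1_A x)%:E + (m `^ p)%:E * (\1_O x)%:E))%E).
  apply: ae_ge0_le_integral => //.
  - by move=> x _; exact: poweR_ge0.
  - apply: (measurableT_comp (measurable_poweR _)).
    by apply: measurableT_comp => //; apply/measurable_EFinP.
  - by move=> x _; rewrite adde_ge0// mule_ge0// lee_fin ?powR_ge0.
  - apply: emeasurable_funD; apply: measurable_funeM;
      apply/measurable_EFinP; exact: measurable_indic.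
  apply: filterS fb => x fx _; rewrite /=.
  rewrite -!EFinM -EFinD lee_fin patchE !indicE.
  case: ifPn => xO; last first.
    by rewrite normr0 powR0 ?gt_eqF// mulr0 addr0 mulr_ge0// powR_ge0.
  have {}fx := fx (set_mem xO); rewrite mulr1.
  apply: (@le_trans _ _ ((if x \in A then M else m) `^ p)).
    by apply: ge0_ler_powR => //; [exact: ltW|rewrite nnegrE; case: (x \in A)].
  by case: (x \in A); rewrite ?mulr1 ?mulr0 ?add0r// lerDl powR_ge0.
rewrite ge0_integralD//=.
- rewrite !ge0_integralZl//; try by [rewrite lee_fin powR_ge0|
    apply/measurable_EFinP; exact: measurable_indic|move=> x _; rewrite lee_fin].
  by rewrite !integral_indic// !setIT.
- by move=> x _; rewrite mule_ge0// lee_fin ?powR_ge0.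
- by apply: measurable_funeM; apply/measurable_EFinP; exact: measurable_indic.
- by move=> x _; rewrite mule_ge0// lee_fin ?powR_ge0.
- by apply: measurable_funeM; apply/measurable_EFinP; exact: measurable_indic.
Qed.

(** The point is to have a large gradient bound [M] weighted by the measure of [A] only. The factor
    [n] comes from [enorm_le], which passes from coordinates to the Euclidean norm. *)
Lemma W1p_C1 (O A : set Rn) (p M m : R) (u : Rn -> R) G :
  open O -> (mu O < +oo)%E -> measurable A -> A `<=` O -> 1 <= p -> 0 <= M -> 0 <= m ->
  has_grad u G -> (forall x, O x -> `|u x| <= m) ->
  (forall x i, O x -> `|G i x| <= if x \in A then M else m) ->
  W1p O p u /\
  (W1p_norm O p u <=
   (((M + m) `^ p)%:E * mu A + (m `^ p)%:E * mu O) `^ p^-1 +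
   (((n%:R * M) `^ p)%:E * mu A + ((n%:R * m) `^ p)%:E * mu O) `^ p^-1)%E.
Proof.
move=> oO Ooo mA AO p1 M0 m0 uG um Gb.
have mO := open_measurable_mx oO.
have p0 : 0 < p by exact: lt_le_trans p1.
have Aoo : (mu A < +oo)%E by apply: le_lt_trans Ooo; apply: le_measure; rewrite ?inE.
have wg := weak_gradient_C1 _ _ _ oO uG.
have mu_ : measurable_fun O u by have [[]] := wg.
have fin (a b : R) : (((a `^ p)%:E * mu A + (b `^ p)%:E * mu O) `^ p^-1 < +oo)%E.
  rewrite poweR_lty// lte_add_pinfty// lte_mul_pinfty// ?lee_fin ?powR_ge0//.
have Lu : (Lp_norm O p u <= (((M + m) `^ p)%:E * mu A + (m `^ p)%:E * mu O) `^ p^-1)%E.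
  apply: Lp_norm_le => //; first by rewrite addr_ge0.
  apply: aeW => x Ox; apply: le_trans (um _ Ox) _.
  by case: ifP => // _; rewrite lerDr.
have Lg g : weak_gradient O u g -> (Lp_norm O p (@enorm R n \o g) <=
    (((n%:R * M) `^ p)%:E * mu A + ((n%:R * m) `^ p)%:E * mu O) `^ p^-1)%E.
  move=> wg'; apply: Lp_norm_le => //; try by rewrite mulr_ge0.
    by apply: measurable_enorm => // i; have [_ /(_ i) []] := wg'.
  have := weak_gradient_unique _ _ _ _ oO wg' wg.
  apply: filterS => x gE Ox; rewrite /= gE// ger0_norm ?enorm_ge0//.
  rewrite -fun_if; apply: enorm_le => [|i]; first by case: ifP.
  by rewrite mxE; exact: Gb.
split; last first.
  apply: leeD => //; apply: Lg.
  (* The default value 0 of [xget] cannot occur, because the classical gradient is a weak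
     gradient. *)
  by rewrite /grad; case: xgetP => [g _ //|] /(_ (fun x => \row_i G i x)).
split => //; first exact: le_lt_trans Lu _.
by exists (fun x => \row_i G i x) => //; exact: le_lt_trans (Lg _ wg) _.
Qed.

End c1_sobolev.

(** * Weak derivatives control difference quotients *)

Section antiderivative.
Context {R : realType}.
Local Notation leb := (@lebesgue_measure R).

Lemma bump_continuous k a b : continuous (@bump R k a b).
Proof. exact/elem1_continuous/elem1_bump. Qed.

Lemma bump_integrable k a b : leb.-integrable setT (EFin \o @bump R k a b).
Proof.
have mI : measurable (`[a, b]%classic : set (measurableTypeR R)) by exact: measurable_itv.
rewrite (_ : EFin \o _ = (EFin \o bump k a b) \_ `[a, b]%classic).
  apply/(integrable_mkcond _ mI).
  apply: continuous_compact_integrable; first exact: segment_compact.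
  exact/continuous_subspaceT/bump_continuous.
apply/funext => t; rewrite patchE; case: ifPn => // /negP; rewrite inE/= in_itv/= => /negP H.
by rewrite bump_eq0//; apply: contra H => /andP[/ltW -> /ltW ->].
Qed.

Lemma bump_antiderivative k a b :
  exists A : R -> R, forall t : R, is_derive t 1 A (bump k a b t).
Proof.
exists (fun x => \int[leb]_(t in `]-oo, x]) (bump k a b t)) => x.
have ix : leb.-integrable `]-oo, x + 1] (EFin \o bump k a b).
  exact: (integrableS measurableT _ (@subsetT _ _) (bump_integrable k a b)).
have xx : x < x + 1 by rewrite ltrDl.
have [||dx dE] := continuous_FTC1 xx ix; [|exact: bump_continuous|].
  exact: ltNyr.
by apply: DeriveDef; [exact: dx|rewrite -derive1E; exact: dE].
Qed.

Lemma derive_eq0_const (A f : R -> R) (x y : R) : x <= y ->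
  (forall t : R, is_derive t 1 A (f t)) -> (forall t, x < t < y -> f t = 0) ->
  A x = A y.
Proof.
rewrite le_eqVlt => /predU1P[->//|xy] dA f0.
have cA : {within `[x, y], continuous A}.
  by apply: continuous_subspaceT => t; exact: is_derive1_continuous (dA t).
have [c cxy E] := @MVT R A f x y xy (fun t _ => dA t) cA.
by apply/esym/eqP; rewrite -subr_eq0 E f0 ?mul0r.
Qed.

(** An antiderivative of [s |-> f (t - s)] is [s |-> - A (t - s)]. *)
Lemma integral_reflected_window (A f : R -> R) (t h : R) : 0 < h -> continuous f ->
  (forall t : R, is_derive t 1 A (f t)) ->
  (\int[leb]_(s in `[0%R, h]) (f (t - s))%:E = (A t - A (t - h))%:E)%E.
Proof.
move=> h0 cf dA.
have dF (s : R) : is_derive s 1 (fun s : R => - A (t - s)) (f (t - s)).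
  have d1 : is_derive s 1 (fun s : R => t - s) (0 - 1).
    exact: is_deriveB (is_derive_cst _ _ _) (is_derive_id _ _).
  have := is_deriveN (@is_derive1_comp R A (fun s => t - s) s _ _ (dA _) d1).
  by rewrite sub0r mulrN1 opprK.
have cF : continuous (fun s : R => - A (t - s)).
  by move=> s; exact: is_derive1_continuous (dF s).
rewrite (@continuous_FTC2 R (fun s => f (t - s)) (fun s : R => - A (t - s)) 0 h h0).
- by rewrite subr0 -EFinB opprK addrC.
- apply: continuous_subspaceT => s.
  apply: (@continuous_comp _ _ _ (fun s : R => t - s) f); last exact: cf.
  by apply: continuousB; [exact: cst_continuous|exact: cvg_id].
- split.
  + by move=> x _; have [] := dF x.
  + exact/cvg_at_right_filter/cF.
  + exact/cvg_at_left_filter/cF.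
- by move=> x _; rewrite derive1E; have [_ ->] := dF x.
Qed.

End antiderivative.

Section smeared_bump.
Context {R : realType} {n : nat}.
Local Notation Rn := 'rV[R]_n.
Local Notation leb := (@lebesgue_measure R).

Lemma subr_delta_coord (x : Rn) (s : R) i j :
  (x - s *: delta_mx 0 i) 0 j = x 0 j - s * (j == i)%R%:R.
Proof. by rewrite !mxE eqxx /=. Qed.

Lemma boxbump_shift k a b (x : Rn) s i : boxbump k a b (x - s *: delta_mx 0 i) =
  bump k (a 0 i) (b 0 i) (x 0 i - s) *
  \prod_(j | j != i) bump k (a 0 j) (b 0 j) (x 0 j).
Proof.
rewrite /boxbump (bigD1 i)//= subr_delta_coord eqxx mulr1; congr (_ * _).
by apply: eq_bigr => j ji; rewrite subr_delta_coord (negbTE ji) mulr0 subr0.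
Qed.

(* [phi] averages the translates of the bump along the [i]-th direction, so its
   [i]-th derivative is a difference of two translates. *)
Lemma smeared_boxbump k (a b : Rn) (i : 'I_n) (h : R) : 0 < h ->
  exists phi : Rn -> R, [/\ test_function setT phi,
    forall x, partial i phi x = boxbump k a b x - boxbump k a b (x - h *: delta_mx 0 i) &
    forall x, (\int[leb]_(s in `[0%R, h]) (boxbump k a b (x - s *: delta_mx 0 i))%:E
       = (phi x)%:E)%E].
Proof.
move=> h0.
have [A dA] := @bump_antiderivative R k (a 0 i) (b 0 i).
(* [Theta t] is the average (times [h]) of the one-dimensional bump over the translates by 0 to [h].
   It is written as a sum and a product to match the constructors of [elem1]. *)
pose Theta t := A t + (-1) * A (t - h).
have eA : elem1 A by apply: elem1_anti dA; exact: elem1_bump.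
have dAh (t : R) : is_derive t 1 (fun t => A (t - h)) (bump k (a 0 i) (b 0 i) (t - h)).
  have d1 : is_derive t 1 (fun s : R => s - h) (1 - 0).
    exact: is_deriveB (is_derive_id _ _) (is_derive_cst _ _ _).
  have := @is_derive1_comp R A (fun s => s - h) t _ _ (dA _) d1.
  by rewrite subr0 mulr1.
have eAh : elem1 (fun t => A (t - h)).
  apply: (elem1_anti _ _ _ dAh).
  rewrite (_ : (fun t => _) = bump k (a 0 i + h) (b 0 i + h)); first exact: elem1_bump.
  by apply/funext => t; rewrite !bumpE; congr (flat 0 (_ * _) * flat 0 (_ * _)); ring.
have eT : elem1 Theta.
  by apply: elem1_add => //; apply: elem1_mul => //; exact: elem1_cst.
pose F j := if j == i then Theta else bump k (a 0 j) (b 0 j).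
have phiE x : \prod_j F j (x 0 j) = Theta (x 0 i) *
    \prod_(j | j != i) bump k (a 0 j) (b 0 j) (x 0 j).
  rewrite (bigD1 i)//= /F eqxx; congr (_ * _).
  by apply: eq_bigr => j /negbTE ->.
exists (fun x => \prod_j F j (x 0 j)); split.
(* The averaging stretches the support by [h] in direction [i]. Outside it [A] is constant between
   [t - h] and [t], so the two terms of [Theta] cancel. *)
- apply: (test_prod _ F a (b + h *: delta_mx 0 i)) => //.
    by move=> j; rewrite /F; case: eqP => // _; exact: elem1_bump.
  move=> j t; rewrite !mxE eqxx /= /F; case: (eqVneq j i) => [->|ji].
    rewrite mulr1 negb_and -!ltNge /Theta mulN1r => /orP[ta|bt].
      rewrite -(@derive_eq0_const R A _ (t - h) t _ dA) ?subrr ?gerBl ?ltW//.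
      move=> s /andP[_ st]; rewrite bump_eq0//.
      by rewrite (ltNge (a 0 i)) (ltW (lt_trans st ta)).
    rewrite -(@derive_eq0_const R A _ (t - h) t _ dA) ?subrr ?gerBl ?ltW//.
    move=> s /andP[ts _]; rewrite bump_eq0//.
    by rewrite negb_and -!leNgt; apply/orP; right; lra.
  rewrite mulr0 addr0 => H; rewrite bump_eq0//.
  by apply: contra H => /andP[/ltW -> /ltW ->].
- move=> x; set c := \prod_(j | j != i) bump k (a 0 j) (b 0 j) (x 0 j).
  have dT : is_derive (x 0 i) 1 (fun t => Theta t * c)
     ((bump k (a 0 i) (b 0 i) (x 0 i) - bump k (a 0 i) (b 0 i) (x 0 i - h)) * c).
    have H := is_deriveD (dA (x 0 i)) (is_deriveM (is_derive_cst (-1 : R) (x 0 i) 1) (dAh (x 0 i))).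
    apply: (@is_derive_eq _ _ _ _ _ _ _ _ (is_deriveM H (is_derive_cst c (x 0 i) 1))).
    by rewrite /GRing.scale/= !mulr0; ring.
  have := @is_derive_along R Rn (fun x => \prod_j F j (x 0 j)) x (delta_mx 0 i)
    (fun t => Theta t * c) (x 0 i) _ _ dT.
  (* The unshifted bump is presented as a shift by 0, so that [boxbump_shift] factors it in the same
     way. *)
  rewrite boxbump_shift -[X in boxbump k a b X - _](subr0 x) -[X in x - X](scale0r (delta_mx 0 i)).
  rewrite boxbump_shift subr0 -mulrBl => H; have [|_ E] := H; last exact: E.
  move=> t; rewrite phiE !mxE !eqxx mulr1; congr (_ * _).
  by apply: eq_bigr => j ji; rewrite !mxE (negbTE ji) mulr0 add0r.
- move=> x; rewrite phiE.
  under eq_integral do rewrite boxbump_shift mulrC EFinM.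
  rewrite integralZl//=.
    rewrite (integral_reflected_window A)//; last exact: bump_continuous.
    by rewrite -EFinM /Theta mulN1r mulrC.
  apply: continuous_compact_integrable; first exact: segment_compact.
  apply: continuous_subspaceT => s.
  apply: (@continuous_comp _ _ _ (fun s : R => x 0 i - s) (bump k (a 0 i) (b 0 i))).
    by apply: continuousB; [exact: cst_continuous|exact: cvg_id].
  exact: bump_continuous.
Qed.

End smeared_bump.

(** * Averages along segments and their duality with averaged bumps *)

Section shift.
Context {R : realType} {n : nat}.
Variables (i : 'I_n) (h : R).
Hypothesis h0 : 0 < h.
Local Notation Rn := 'rV[R]_n.
Local Notation mu := (vol R n).
Local Notation leb := (@lebesgue_measure R).
Local Notation T2 := (measurableTypeR R).
Local Notation e := (delta_mx 0 i : Rn).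

(** The coefficient [c] is 1 when the gradient is moved forward, -1 when the bump is moved backward,
    and 0 when nothing moves. *)
Definition shear (c : R) (z : Rn * T2) : Rn := z.1 + (c * (z.2 : R)) *: e.

Lemma measurable_shear c : measurable_fun [set: Rn * T2] (shear c).
Proof.
apply: measurable_fun_mx => k j; rewrite /shear.
under eq_fun do rewrite !mxE.
apply: measurable_funD.
  exact: (measurableT_comp (measurable_coord_mx k j) measurable_fst).
by apply: measurable_funM => //; apply: measurable_funM => //; exact: measurable_snd.
Qed.

Definition window (s : R) : R := \1_(`[0%R, h]%classic) s.

Lemma measurable_window : measurable_fun [set: T2] (window : T2 -> R).
Proof. by apply: measurable_indic; exact: measurable_itv. Qed.

Lemma integral_window : (\int[leb]_s (window s)%:E = h%:E)%E.
Proof.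
rewrite integral_indic//=.
by rewrite setIT lebesgue_measure_itv/= lte_fin h0 -EFinB subr0.
Qed.

Lemma integral_window_mkcond (f : R -> \bar R) :
  (\int[leb]_s ((window s)%:E * f s) = \int[leb]_(s in `[0%R, h]) f s)%E.
Proof.
rewrite [RHS]integral_mkcond; apply: eq_integral => s _.
by rewrite patchE /window indicE; case: ifP => _; rewrite ?mul1e ?mul0e.
Qed.

Variable (gam : Rn -> R).
Hypothesis gi : mu.-integrable setT (EFin \o gam).

Let mgam : measurable_fun setT gam.
Proof. by have /measurable_int/measurable_EFinP := gi. Qed.

Lemma measurable_shear_window c (B : Rn * T2 -> R) : measurable_fun setT B ->
  measurable_fun setT (fun z : Rn * T2 => gam (shear c z) * (window z.2 * B z)).
Proof.
move=> mB; apply: measurable_funM.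
  exact: (measurableT_comp mgam (measurable_shear c)).
apply: measurable_funM => //.
exact: (measurableT_comp measurable_window measurable_snd).
Qed.

Lemma window_ge0 s : 0 <= window s.
Proof. by rewrite /window indicE. Qed.

(** Integrating in [x] first, translation invariance makes the inner integral at most the L^1 norm
    of [gam] for every [s], and the window has mass [h]. This is the hypothesis of every later use
    of Fubini. *)
Lemma integrable_shear_window c (B : Rn * T2 -> R) : measurable_fun setT B ->
  (forall z, `|B z| <= 1) ->
  (mu \x leb)%E.-integrable setT
    (fun z : Rn * T2 => (gam (shear c z) * (window z.2 * B z))%:E).
Proof.
move=> mB B1; have mf := measurable_shear_window c _ mB.
apply/integrable21ltyP; first exact/measurable_EFinP.
have mF : measurable_fun setT (fun z : Rn * T2 =>
    `|(gam (shear c z) * (window z.2 * B z))%:E|%E).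
  by apply: measurableT_comp => //; exact/measurable_EFinP.
have C0 : (0 <= \int[mu]_x `|(gam x)%:E|)%E by exact: integral_ge0.
have Coo : (\int[mu]_x `|(gam x)%:E| < +oo)%E by have /integrableP[] := gi.
have magam : measurable_fun setT (fun x => `|(gam x)%:E|%E).
  by apply: measurableT_comp => //; exact/measurable_EFinP.
apply: (@le_lt_trans _ _ (\int[leb]_s ((window s)%:E * \int[mu]_x `|(gam x)%:E|))%E).
  apply: ge0_le_integral => //.
  - by move=> s _; exact: integral_ge0.
  - by apply: (measurable_fun_fubini_tonelli_G _ mF) => z.
  - apply: emeasurable_funM; last exact: measurable_cst.
    by apply/measurable_EFinP; exact: measurable_window.
  move=> s _.
  rewrite -(ge0_integral_translate _ ((c * s) *: e) _ magam)//.
  have mt : measurable_fun setT (fun x : Rn => `|(gam (x + (c * s) *: e))%:E|%E).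
    exact: (measurableT_comp magam (measurable_addmx _ _)).
  rewrite -ge0_integralZl//; last by rewrite lee_fin window_ge0.
  apply: ge0_le_integral => //.
  - apply: (measurableT_comp mF).
    exact: pair2_measurable.
  - by apply: measurable_funeM.
  move=> x _; rewrite /= lee_fin !normrM mulrC (ger0_norm (window_ge0 s)).
  rewrite ler_wpM2r// ler_piMr// window_ge0//.
rewrite ge0_integralZr//; first last.
- by move=> s _; rewrite lee_fin window_ge0.
- by apply/measurable_EFinP; exact: measurable_window.
by rewrite integral_window lte_mul_pinfty// lee_fin ltW.
Qed.

End shift.

Section shift_smear.
Context {R : realType} {n : nat}.
Variables (i : 'I_n) (h : R).
Hypothesis h0 : 0 < h.
Local Notation Rn := 'rV[R]_n.
Local Notation mu := (vol R n).
Local Notation leb := (@lebesgue_measure R).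
Local Notation T2 := (measurableTypeR R).
Local Notation e := (delta_mx 0 i : Rn).

Variable (gam : Rn -> R).
Hypothesis gi : mu.-integrable setT (EFin \o gam).

Let mgam : measurable_fun setT gam.
Proof. by have /measurable_int/measurable_EFinP := gi. Qed.

(** The integral of [gam (x + s e)] for [s] from 0 to [h]. The factor 1 makes the integrand an
    instance of [integrable_shear_window]; the value is finite for almost every [x] only. *)
Definition smear (x : Rn) : \bar R :=
  (\int[leb]_s (gam (shear i 1 (x, s)) * (window h s * 1))%:E)%E.

Let iB : (mu \x leb)%E.-integrable setT
    (fun z : Rn * T2 => (gam (shear i 1 z) * (window h z.2 * 1))%:E).
Proof.
apply: (integrable_shear_window i h h0 gam gi 1 (cst 1)) => // z.
by rewrite normr1.
Qed.

Lemma integrable_smear : mu.-integrable setT smear.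
Proof. exact: (integrable_fubini_F iB). Qed.

Lemma integrable_fine_smear : mu.-integrable setT (EFin \o (fine \o smear)).
Proof.
have mS : measurable_fun setT smear := measurable_int _ integrable_smear.
apply: le_integrable integrable_smear => //.
  by apply/measurable_EFinP; apply: measurableT_comp.
by move=> x _ /=; case: (smear x) => [r| |] /=; rewrite ?leey ?lexx.
Qed.

Lemma window_integrable (f : R -> R) : continuous f -> (forall s, `|f s| <= 1) ->
  leb.-integrable setT (fun s => (window h s * f s)%:E).
Proof.
move=> cf f1; apply/integrableP; split.
  apply/measurable_EFinP; apply: measurable_funM; first exact: measurable_window.
  exact: continuous_measurable_fun.
apply: (@le_lt_trans _ _ (\int[leb]_s (window h s)%:E)%E).
  apply: ge0_le_integral => //.
  - apply: measurableT_comp => //; apply/measurable_EFinP.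
    by apply: measurable_funM; [exact: measurable_window|exact: continuous_measurable_fun].
  - by apply/measurable_EFinP; exact: measurable_window.
  by move=> s _; rewrite /= lee_fin normrM (ger0_norm (window_ge0 _ _)) ler_piMr// window_ge0.
by rewrite integral_window// ltry.
Qed.

(** Averaging forward and averaging backward are adjoint: after Fubini, for each [s], the
    substitution of [x - s e] for [x] moves the shift from [gam] to the bump, and a second Fubini
    rebuilds [phi]. *)
Lemma integral_smear_boxbump k a b (phi : Rn -> R) :
  (forall x, (\int[leb]_(s in `[0%R, h]) (boxbump k a b (x - s *: e))%:E
       = (phi x)%:E)%E) ->
  (\int[mu]_x (fine (smear x) * boxbump k a b x)%:E = \int[mu]_x (gam x * phi x)%:E)%E.
Proof.
move=> phiE; set psi := boxbump k a b.
have cpsi : continuous psi by exact: boxbump_continuous.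
have mpsi : measurable_fun setT psi by exact: continuous_measurable_mx.
have psi1 x : `|psi x| <= 1 by rewrite ger0_norm ?boxbump_ge0 ?boxbump_le1.
have i1 : (mu \x leb)%E.-integrable setT
    (fun z : Rn * T2 => (gam (shear i 1 z) * (window h z.2 * psi z.1))%:E).
  apply: (integrable_shear_window i h h0 gam gi 1 (fun z => psi z.1)) => //.
  exact: (measurableT_comp mpsi measurable_fst).
have i2 : (mu \x leb)%E.-integrable setT
    (fun z : Rn * T2 => (gam (shear i 0 z) * (window h z.2 * psi (shear i (-1) z)))%:E).
  apply: (integrable_shear_window i h h0 gam gi 0 (fun z => psi (shear i (-1) z))) => //.
  exact: (measurableT_comp mpsi (measurable_shear i (-1))).
transitivity (\int[mu]_x \int[leb]_s (gam (shear i 1 (x, s)) * (window h s * psi x))%:E)%E.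
  apply: ae_eq_integral => //.
  - apply/measurable_EFinP; apply: measurable_funM => //.
    by have /measurable_int/measurable_EFinP := integrable_fine_smear.
  - exact: measurable_int (integrable_fubini_F i1).
  (* Undoing [fine] is legitimate at the points where the section is integrable, that is, almost
     everywhere. *)
  have := ae_integrable1 iB; apply: filterS => x ix _.
  have fx := integrable_fin_num measurableT ix.
  rewrite EFinM fineK// /smear /= -integralZr//.
  by apply: eq_integral => s _; rewrite -EFinM mulr1 -!mulrA.
rewrite (Fubini i1).
transitivity (\int[leb]_s \int[mu]_x
    (gam (shear i 0 (x, s)) * (window h s * psi (shear i (-1) (x, s))))%:E)%E.
  apply: eq_integral => s _.
  pose H (y : Rn) := (gam y * (window h s * psi (y - s *: e)))%:E.
  have mH : measurable_fun setT (fun y : Rn => window h s * psi (y - s *: e)).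
    apply: measurable_funM => //.
    exact: (measurableT_comp mpsi (measurable_addmx _ _)).
  have Hi : mu.-integrable setT H.
    apply: (integrable_mulr_bounded setT gam _ 1) => // y _.
    rewrite normrM mulr_ile1// /window indicE; by case: (_ \in _); rewrite ?normr1 ?normr0.
  transitivity (\int[mu]_x H x)%E.
    rewrite -(integral_translate _ (s *: e) _ Hi); apply: eq_integral => x _.
    by rewrite /H /shear /= mul1r addrK.
  apply: eq_integral => x _.
  by rewrite /H /shear /= mul0r scale0r addr0 mulN1r scaleNr.
rewrite -(Fubini i2); apply: eq_integral => x _.
under eq_integral do rewrite /shear /= mul0r scale0r addr0 mulN1r scaleNr EFinM.
rewrite integralZl//; last first.
  apply: window_integrable => // s.
  apply: (@continuous_comp _ _ _ (fun s : R => x - s *: e) psi); last exact: cpsi.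
  by apply: cvgB; [exact: cvg_cst|exact: scalel_continuous].
rewrite EFinM -phiE -integral_window_mkcond.
by under [in RHS]eq_integral do rewrite -EFinM.
Qed.

End shift_smear.

Section shift_ae.
Context {R : realType} {n : nat}.
Variables (i : 'I_n) (h : R).
Hypothesis h0 : 0 < h.
Local Notation Rn := 'rV[R]_n.
Local Notation mu := (vol R n).
Local Notation leb := (@lebesgue_measure R).
Local Notation e := (delta_mx 0 i : Rn).

(** With psi a box bump and phi its backward average, the integral of (v(x + h e) - v(x)) psi equals
    that of v (psi(x - h e) - psi), which is minus that of v d_i phi, hence that of g_i phi, hence
    that of the smeared gradient times psi. The fundamental lemma then gives equality almost
    everywhere. *)
Lemma weak_gradient_shift (v : Rn -> R) (g : Rn -> Rn) (a0 b0 : Rn) :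
  weak_gradient setT v g ->
  let gam := (fun x => g x 0 i) \_ (cbox a0 (b0 + h *: e)) in
  mu.-integrable setT (EFin \o gam) /\
  {ae mu, forall x, obox a0 b0 x -> v (x + h *: e) - v x = fine (smear i h gam x)}.
Proof.
move=> [[mv vi] lg wg] gam.
(* [g] is only locally integrable, whereas Fubini is applied on the whole space. [Q] contains every
   segment from a point [x] of the box to [x + h e], so truncating to it loses nothing. *)
set Q := cbox a0 (b0 + h *: e) in gam *.
have mQ : measurable Q by exact: cbox_measurable.
have gi : mu.-integrable setT (EFin \o gam).
  rewrite /gam -restrict_EFin; apply/(integrable_mkcond _ mQ).
  by apply: (lg i).2 => //; exact: cbox_compact.
split => //.
have mO := obox_measurable a0 b0.
pose D x := v (x + h *: e) - v x - fine (smear i h gam x).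
have mvh : measurable_fun setT (fun x : Rn => v (x + h *: e)).
  exact: (measurableT_comp mv (measurable_addmx _ _)).
have si := integrable_fine_smear i h h0 gam gi.
have ms : measurable_fun setT (fine \o smear i h gam).
  by have /measurable_int/measurable_EFinP := si.
suff : {ae mu, forall x, obox a0 b0 x -> D x = 0}.
  by apply: filterS => x H /H /eqP; rewrite subr_eq0 => /eqP.
have lvh : loc_integrable setT (fun x : Rn => v (x + h *: e)).
  split => // K cK _; have mK := compact_measurable _ cK.
  have [M [_ HM]] := compact_bounded cK.
  pose r := `|M| + 1 + h; pose K' := cbox (const_mx (- r)) (const_mx r : Rn).
  have mK' : measurable K' by exact: cbox_measurable.
  have vK : mu.-integrable setT ((EFin \o v) \_ K').
    by apply/(integrable_mkcond _ mK'); apply: vi => //; exact: cbox_compact.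
  have := integrable_translate _ (h *: e) _ (measurable_int _ vK) vK.
  move=> /(integrableS measurableT mK (@subsetT _ _)).
  apply: eq_integrable => // x; rewrite inE => Kx; rewrite patchE mem_set//.
  move=> j; rewrite !mxE eqxx /= -ler_norml (le_trans (ler_normD _ _))//.
  apply: lerD; last first.
    rewrite normrM (gtr0_norm h0) ler_piMr ?(ltW h0)//.
    by case: eqP; rewrite ?normr1 ?normr0.
  apply: le_trans (coord_le_norm _ x j) _; apply: HM => //.
  by rewrite (le_lt_trans (ler_norm _))// ltrDl.
have lD : loc_integrable setT D.
  split; first by apply: measurable_funB => //; exact: measurable_funB.
  move=> K cK _; have mK := compact_measurable _ cK.
  have H := integrableB mK (lvh.2 _ cK (@subsetT _ _)) (vi _ cK (@subsetT _ _)).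
  have H' := integrableB mK H (integrableS measurableT mK (@subsetT _ _) si).
  exact: H'.
have oO : open (obox a0 b0) by exact: obox_open.
apply: ae_eq0_of_boxbump => //.
  split; first by apply: measurable_funTS; exact: lD.1.
  by move=> K cK _; exact: lD.2.
move=> k a b abO; set psi := boxbump k a b.
have cpsi : continuous psi by exact: boxbump_continuous.
have psi0 x : ~ cbox a b x -> psi x = 0 by exact: boxbump_eq0.
have Ipsi f : loc_integrable setT f -> mu.-integrable setT (fun x => (f x * psi x)%:E).
  move=> lf; apply: (integrable_mul_csupp _ (cbox a b)) => //.
  exact: cbox_compact.
rewrite (Rintegral_csupp (obox a0 b0) (cbox a b)) => //; last by move=> x /psi0 ->; rewrite mulr0.
have [phi [tphi dphi phiE]] := smeared_boxbump k a b i h h0.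
(* A point off [Q] has none of its translates [x - s e], with [s] from 0 to [h], in the closed box
   of the bump. Hence [gam] may be replaced by the full component of [g] when paired with [phi]. *)
have phi0 x : ~ Q x -> phi x = 0.
  move=> Qx; apply: EFin_inj; rewrite -phiE integral0_eq// => s /=; rewrite in_itv/= => /andP[s0 sh].
  congr EFin; apply: boxbump_eq0 => H; apply: Qx => j.
  have := abO _ H j; rewrite !mxE eqxx /=.
  have [->|ji] := eqVneq j i; rewrite ?mulr1 ?mulr0 => /andP[? ?]; apply/andP; split; lra.
have lv : loc_integrable setT v by [].
have lsm : loc_integrable setT (fine \o smear i h gam).
  split => // K cK _; have mK := compact_measurable _ cK.
  exact: (integrableS measurableT mK (@subsetT _ _) si).
have E1 : \int[mu]_x (fine (smear i h gam x) * psi x) = \int[mu]_x (g x 0 i * phi x).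
  rewrite /Rintegral (integral_smear_boxbump i h h0 gam gi k a b phi phiE); congr fine.
  apply: eq_integral => x _; rewrite /gam patchE.
  case: ifPn => // /negP; rewrite inE => /phi0 ->; by rewrite !mulr0.
pose H y := v y * psi (y - h *: e).
have cpsih : continuous (fun y : Rn => psi (y - h *: e)).
  move=> y; apply: (@continuous_comp _ _ _ (fun y : Rn => y - h *: e) psi); last exact: cpsi.
  by apply: (@continuousB _ _ _ (fun y : Rn => y) (cst (h *: e)));
    [exact: cvg_id|exact: cst_continuous].
have Hi : mu.-integrable setT (EFin \o H).
  apply: (integrable_mul_csupp _ (cbox (a + h *: e) (b + h *: e))) => //.
    exact: cbox_compact.
  move=> x H'; apply: psi0 => H''; apply: H' => j; have := H'' j; rewrite !mxE.
  by rewrite lerBrDr lerBlDr.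
have E2 : \int[mu]_x (v (x + h *: e) * psi x) = \int[mu]_x H x.
  congr fine; rewrite -[RHS](integral_translate _ (h *: e) (EFin \o H) Hi).
  by apply: eq_integral => x _; rewrite /= /H addrK.
have E3 := wg phi i tphi.
under eq_Rintegral do rewrite !mulrBl.
have ID := integrableB measurableT (Ipsi _ lvh) (Ipsi _ lv).
rewrite RintegralB; [|exact: measurableT|exact: ID|exact: (Ipsi _ lsm)].
rewrite RintegralB; [|exact: measurableT|exact: (Ipsi _ lvh)|exact: (Ipsi _ lv)].
have E4 : \int[mu]_x (v x * partial i phi x) =
    \int[mu]_x (v x * psi x) - \int[mu]_x H x.
  under eq_Rintegral do rewrite dphi mulrBr.
  by rewrite RintegralB; [|exact: measurableT|exact: (Ipsi _ lv)|exact: Hi].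
rewrite E4 in E3; rewrite E2 E1 -(opprK (\int[mu]_x (g x 0 i * phi x))) -E3.
by rewrite opprK addrC subrKA subrr.
Qed.

End shift_ae.

Section shift_bound.
Context {R : realType} {n : nat}.
Variables (i : 'I_n) (h : R).
Hypothesis h0 : 0 < h.
Local Notation Rn := 'rV[R]_n.
Local Notation mu := (vol R n).
Local Notation leb := (@lebesgue_measure R).
Local Notation T2 := (measurableTypeR R).
Local Notation e := (delta_mx 0 i : Rn).

(* Plays the role of Hoelder's inequality in [shift_measure_le], and covers q = 1. *)
Lemma ler_half_powR (q t : R) : 1 <= q -> 0 <= t ->
  t <= 2^-1 + 2 `^ (q - 1) * t `^ q.
Proof.
move=> q1 t0; have [t2|t2] := leP t 2^-1.
  by apply: le_trans t2 _; rewrite lerDl mulr_ge0// powR_ge0.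
have tt : 1 <= 2 * t by lra.
have q0 : q != 0 by rewrite gt_eqF// (lt_le_trans _ q1).
have H : (2 * t) `^ q = 2 * (2 `^ (q - 1) * t `^ q).
  rewrite powRM// powRB ?powRr1//; last by rewrite ?pnatr_eq0// implybT.
  by rewrite mulrA mulrC; field.
have : 2 * t <= (2 * t) `^ q.
  rewrite -[leLHS]powRr1; last lra.
  by rewrite ler_powR.
rewrite H ler_pM2l// => H'; apply: le_trans H' _.
by rewrite lerDr.
Qed.

(** On [A] the jump [d] is at most the integral of |gam(x + s e)| over [s]. After exchanging the
    integrals, [ler_half_powR] is applied for each [s], and translation invariance removes the shift
    from the q-th power. For [d = h] the term with 1/2 can be absorbed. *)
Lemma shift_measure_le (v : Rn -> R) (g : Rn -> Rn) (A : set Rn) (a0 b0 : Rn) (d q : R) :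
  weak_gradient setT v g -> measurable A -> A `<=` obox a0 b0 -> 0 <= d -> 1 <= q ->
  {ae mu, forall x, A x -> v (x + h *: e) - v x = d} ->
  (d%:E * mu A <= h%:E * ((2^-1)%:E * mu A +
     (2 `^ (q - 1))%:E * \int[mu]_x (`|g x 0 i| `^ q)%:E))%E.
Proof.
move=> wg mA AO d0 q1 vd.
have [gi sE] := weak_gradient_shift i h h0 v g a0 b0 wg.
set gam := _ \_ _ in gi sE.
have mg : measurable_fun setT (fun x => g x 0 i) by have [_ /(_ i) []] := wg.
have mgam : measurable_fun setT gam by have /measurable_int/measurable_EFinP := gi.
have mS := measurable_int _ (integrable_smear i h h0 gam gi).
have mabs c : measurable_fun setT (fun z : Rn * T2 => `|gam (shear i c z)|).
  by apply: measurableT_comp => //; exact: (measurableT_comp mgam (measurable_shear i c)).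
pose f (z : Rn * T2) := (`|gam (shear i 1 z)| * (window h z.2 * \1_A z.1))%:E.
have m1A : measurable_fun setT (\1_A : Rn -> R) by exact: measurable_indic.
have mf : measurable_fun setT f.
  apply/measurable_EFinP; apply: measurable_funM => //; apply: measurable_funM.
    exact: (measurableT_comp (measurable_window h) measurable_snd).
  exact: (measurableT_comp m1A measurable_fst).
have f0 z : (0 <= f z)%E.
  by rewrite lee_fin !mulr_ge0// ?window_ge0// indicE.
set C := (_ + _)%E.
have I0 : (0 <= \int[mu]_x (`|g x 0 i| `^ q)%:E)%E.
  by apply: integral_ge0 => x _; rewrite lee_fin powR_ge0.
have C0 : (0 <= C)%E.
  by rewrite adde_ge0// mule_ge0// lee_fin ?powR_ge0// invr_ge0.
have -> : (d%:E * mu A = \int[mu]_x (d%:E * (\1_A x)%:E))%E.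
  rewrite ge0_integralZl//; first by rewrite integral_indic// setIT.
  exact/measurable_EFinP.
apply: (@le_trans _ _ (\int[mu]_x \int[leb]_s f (x, s))%E).
  apply: ae_ge0_le_integral => //.
  - by move=> x _; rewrite mule_ge0.
  - by apply: measurable_funeM; exact/measurable_EFinP.
  - by move=> x _; exact: integral_ge0.
  - exact: (measurable_fun_fubini_tonelli_F _ mf f0).
  apply: filterS2 vd sE => x vd sE _.
  rewrite indicE; case: (boolP (x \in A)) => [/set_mem Ax|_]; last first.
    by rewrite mule0; exact: integral_ge0.
  rewrite mule1 -(vd Ax) (sE (AO _ Ax)).
  (* [fine] sends an infinite value to 0, so the bound by the absolute value holds in that case
     too. *)
  apply: (@le_trans _ _ `|smear i h gam x|%E).
    by case: (smear i h gam x) => [r| |] /=; rewrite ?lee_fin ?ler_norm ?leey.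
  apply: le_trans (le_abse_integral _ _ _) _ => //.
    apply/measurable_EFinP.
    have := measurable_shear_window i h gam gi 1 (cst 1) (measurable_cst _).
    by move/measurableT_comp => /(_ _ _ _ _ (pair1_measurable x)).
  rewrite le_eqVlt; apply/orP; left; apply/eqP; apply: eq_integral => s _.
  rewrite /f /= indicE mem_set// mulr1 normrM ?mulr1.
  by rewrite (ger0_norm (window_ge0 _ _)).
rewrite (fubini_tonelli f)//.
apply: (@le_trans _ _ (\int[leb]_s ((window h s)%:E * C))%E); last first.
  rewrite ge0_integralZr//.
  - by rewrite integral_window.
  - by apply/measurable_EFinP; exact: measurable_window.
  - by move=> s _; rewrite lee_fin window_ge0.
apply: ge0_le_integral => //.
- by move=> s _; exact: integral_ge0.
- exact: (measurable_fun_fubini_tonelli_G _ mf f0).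
- apply: emeasurable_funM; last exact: measurable_cst.
  by apply/measurable_EFinP; exact: measurable_window.
move=> s _.
have mt : measurable_fun setT (fun x : Rn => gam (x + (1 * s) *: e)).
  exact: (measurableT_comp mgam (measurable_addmx _ _)).
have mq (u : Rn -> R) : measurable_fun setT u -> measurable_fun setT (fun x => (`|u x| `^ q)%:E).
  move=> mu_; apply/measurable_EFinP.
  by apply: (measurableT_comp (measurable_powR _)); exact: measurableT_comp.
apply: (@le_trans _ _ (\int[mu]_x ((window h s)%:E * ((2^-1)%:E * (\1_A x)%:E +
    (2 `^ (q - 1))%:E * (`|gam (x + (1 * s) *: e)%R| `^ q)%:E)))%E).
  apply: ge0_le_integral => //.
  - exact: (measurableT_comp mf (pair2_measurable _)).
  - apply: measurable_funeM; apply: emeasurable_funD; apply: measurable_funeM.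
      exact/measurable_EFinP.
    exact: mq.
  move=> x _; rewrite /f /= mulrCA EFinM; apply: lee_pmul => //.
  + by rewrite lee_fin window_ge0.
  rewrite -!EFinM -EFinD lee_fin /shear /=.
  have := ler_half_powR q _ q1 (normr_ge0 (gam (x + (1 * s) *: e))).
  rewrite indicE; case: (x \in A) => H; first by rewrite !mulr1.
  by rewrite !mulr0 add0r mulr_ge0// powR_ge0.
have mgq := mq _ mt.
rewrite ge0_integralZl//; first last.
- by rewrite lee_fin window_ge0.
- by move=> x _; rewrite adde_ge0// ?mule_ge0// lee_fin ?powR_ge0// invr_ge0.
- apply: emeasurable_funD; apply: measurable_funeM => //.
  exact/measurable_EFinP.
apply: lee_pmul => //.
- by rewrite lee_fin window_ge0.
- by apply: integral_ge0 => x _; rewrite adde_ge0// ?mule_ge0// lee_fin ?powR_ge0// invr_ge0.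
rewrite ge0_integralD//;
  try by [apply: measurable_funeM => //; exact/measurable_EFinP
         |move=> x _; rewrite ?mule_ge0// lee_fin ?powR_ge0// invr_ge0].
rewrite !ge0_integralZl//;
  try by [exact/measurable_EFinP|move=> x _; rewrite lee_fin powR_ge0
         |rewrite lee_fin powR_ge0].
rewrite integral_indic// setIT; apply: leeD; first exact: lexx.
apply: lee_pmul; [by rewrite lee_fin powR_ge0| |exact: lexx|].
  by apply: integral_ge0 => x _; rewrite lee_fin powR_ge0.
have mgamq := mq _ mgam.
rewrite (ge0_integral_translate _ _ (fun x => (`|gam x| `^ q)%:E))//.
apply: ge0_le_integral => //; first exact: mq.
move=> x _; rewrite lee_fin; apply: ge0_ler_powR; rewrite ?nnegrE//.
  exact: le_trans q1.
by rewrite /gam patchE; case: ifP => // _; rewrite normr0.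
Qed.

End shift_bound.

(** * Oscillating test functions *)

Section cutoff.
Context {R : realType}.

Lemma flat0_gt0 (t : R) : 0 < t -> 0 < flat 0 t.
Proof. by move=> t0; rewrite /flat t0 expr0 mul1r expR_gt0. Qed.

Lemma bump_gt0 k (a b t : R) : a < t < b -> 0 < bump k a b t.
Proof.
by move=> /andP[at_ tb]; rewrite bumpE mulr_gt0// flat0_gt0// mulr_gt0// subr_gt0.
Qed.

(** The antiderivative of a bump on the unit interval, normalised by its total increase [K]. The
    mean value theorem gives [K > 0], since the bump is positive inside. *)
Lemma smooth_step : exists c c' : R -> R, exists L : R,
  [/\ forall t : R, is_derive t 1 c (c' t), continuous c',
      forall t, t <= 0 -> c t = 0, forall t, 1 <= t -> c t = 1 &
      (forall t, 0 <= c t <= 1) /\ forall t, `|c' t| <= L].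
Proof.
have [A dA] := @bump_antiderivative R 0 0 1.
have cA x y : {within `[x, y], continuous A}.
  by apply: continuous_subspaceT => t; exact: is_derive1_continuous (dA t).
have mvt x y : x < y -> exists2 t, x < t < y & A y - A x = bump 0 0 1 t * (y - x).
  move=> xy; have [t txy E] := @MVT R A _ x y xy (fun t _ => dA t) (cA x y).
  by exists t => //; move: txy; rewrite in_itv.
pose K := A 1 - A 0.
have K0 : 0 < K.
  by rewrite /K; have [t t01 ->] := mvt 0 1 ltr01; rewrite subr0 mulr1 bump_gt0.
have nd x y : x <= y -> A x <= A y.
  rewrite le_eqVlt => /predU1P[->//|xy].
  rewrite -subr_ge0; have [t _ ->] := mvt _ _ xy.
  by rewrite mulr_ge0 ?bump_ge0// subr_ge0 ltW.
exists (fun t => K^-1 * (A t - A 0)), (fun t => K^-1 * bump 0 0 1 t), K^-1.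
have c0 t : t <= 0 -> K^-1 * (A t - A 0) = 0.
  move=> t0; rewrite (@derive_eq0_const R A _ t 0 t0 dA) ?subrr ?mulr0// => s /andP[_ s0].
  by rewrite bump_eq0// (ltNge 0) (ltW s0).
have c1 t : 1 <= t -> K^-1 * (A t - A 0) = 1.
  move=> t1; rewrite -(@derive_eq0_const R A _ 1 t t1 dA) ?mulVf ?gt_eqF// => s /andP[s1 _].
  by rewrite bump_eq0// negb_and -!leNgt (ltW s1) orbT.
split => //.
- move=> t; have H := is_deriveB (dA t) (is_derive_cst (A 0) t 1).
  have := is_deriveZ K^-1 H.
  by rewrite subr0.
- move=> t; apply: (@continuousM _ _ (cst K^-1) (bump 0 0 1)); first exact: cst_continuous.
  exact: bump_continuous.
- split => t.
    have [t0|t0] := leP t 0; first by rewrite c0// lexx ler01.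
    have [t1|t1] := leP 1 t; first by rewrite c1// lexx ler01.
    rewrite mulr_ge0 ?invr_ge0 ?(ltW K0) ?subr_ge0 ?nd ?(ltW t0)//=.
    by rewrite mulrC ler_pdivrMr// mul1r lerB// nd// ltW.
  rewrite normrM (ger0_norm (bump_ge0 _ _ _ _)) ger0_norm ?invr_ge0 ?(ltW K0)//.
  by rewrite ler_piMr ?invr_ge0 ?(ltW K0)// bump_le1.
Qed.

Context {n : nat}.
Local Notation Rn := 'rV[R]_n.
Local Notation mu := (vol R n).

Lemma has_grad_comp (u : Rn -> R) G (c c' : R -> R) : has_grad u G ->
  (forall t : R, is_derive t 1 c (c' t)) -> continuous c' ->
  has_grad (fun x => c (u x)) (fun i x => c' (u x) * G i x).
Proof.
move=> [cu cG du] dc cc'.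
have cc : continuous c by move=> t; exact: is_derive1_continuous (dc t).
split.
- by move=> x; apply: (@continuous_comp _ _ _ u c); [exact: cu|exact: cc].
- move=> i x; apply: (@continuousM _ _ (fun x => c' (u x)) (G i)); last exact: cG.
  by apply: (@continuous_comp _ _ _ u c'); [exact: cu|exact: cc'].
- move=> x i.
  have d1 : is_derive (0 : R) 1 (fun t : R => u (t *: delta_mx 0 i + x)) (G i x).
    by apply: is_derive_line; rewrite scale0r add0r; exact: du.
  have dc0 := dc (u ((0 : R) *: delta_mx 0 i + x)).
  have d2 := @is_derive1_comp R c (fun t : R => u (t *: delta_mx 0 i + x)) 0 _ _ dc0 d1.
  have E : u ((0 : R) *: delta_mx 0 i + x) = u x by rewrite scale0r add0r.
  rewrite E in d2.
  apply: (@is_derive_along _ _ _ _ _ (c \o (fun t : R => u (t *: delta_mx 0 i + x))) 0 _ _ d2).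
  by move=> t; rewrite /= addr0.
Qed.

Lemma has_grad_mul (u v : Rn -> R) G H : has_grad u G -> has_grad v H ->
  has_grad (fun x => u x * v x) (fun i x => u x * H i x + v x * G i x).
Proof.
move=> [cu cG du] [cv cH dv]; split.
- by move=> x; exact: continuousM (cu x) (cv x).
- by move=> i x; exact: continuousD (continuousM (cu x) (cH i x)) (continuousM (cv x) (cG i x)).
- by move=> x i; exact: is_deriveM (du x i) (dv x i).
Qed.

Lemma has_grad_coord (F f : R -> R) (j : 'I_n) :
  (forall t : R, is_derive t 1 F (f t)) -> continuous f ->
  has_grad (fun x : Rn => F (x 0 j)) (fun i x => (j == i)%R%:R * f (x 0 j)).
Proof.
move=> dF cf; have cF : continuous F by move=> t; exact: is_derive1_continuous (dF t).
split.
- move=> x; apply: (@continuous_comp _ _ _ (fun y : Rn => y 0 j) F); last exact: cF.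
  exact: coord_continuous.
- move=> i x; apply: (@continuousM _ _ (cst (j == i)%R%:R) (fun x : Rn => f (x 0 j))).
    exact: cst_continuous.
  apply: (@continuous_comp _ _ _ (fun y : Rn => y 0 j) f); last exact: cf.
  exact: coord_continuous.
- by move=> x i; apply: is_derive_coord; exact: dF.
Qed.

Lemma elem_has_grad (u : Rn -> R) : elem u -> exists G, has_grad u G.
Proof.
move=> eu; pose P i g := elem g /\ forall x, is_derive x (delta_mx 0 i) u (g x).
have H i : exists g, P i g by have [g eg dg] := elem_derive _ i eu; exists g.
exists (fun i => sval (cid (H i))); split; first exact: elem_continuous.
- by move=> i; case: cid => g [/= eg _]; exact: elem_continuous.
- by move=> x i; case: cid => g [/= _ dg]; exact: dg.
Qed.

(** A finite sum of bumps subordinate to [O] vanishes outside [O], and a smooth step composed with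
    it separates its small values from the larger ones. The points of [O] with small values form a
    set whose measure tends to 0 as bumps are added, by continuity from above. *)
Lemma cutoff (O : set Rn) (eps : R) : open O -> (mu O < +oo)%E -> 0 < eps ->
  exists eta G V A, [/\ has_grad eta G, forall x : Rn, 0 <= eta x <= 1,
    [/\ open V, ~` O `<=` V & forall x, V x -> eta x = 1] &
    [/\ measurable A, A `<=` O, (mu A < eps%:E)%E & forall x, O x -> ~ A x -> eta x = 0]].
Proof.
move=> oO Ooo eps0; have mO := open_measurable_mx oO.
have [c [c' [L [dc cc' c0 c1 [c01 _]]]]] := smooth_step.
pose lo (b : 'M[rat]_(1, n) * nat) : Rn := map_mx ratr b.1 - const_mx b.2.+1%:R^-1.
pose hi (b : 'M[rat]_(1, n) * nat) : Rn := map_mx ratr b.1 + const_mx b.2.+1%:R^-1.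
have boxE b : @rat_box R 1 n b = obox (lo b) (hi b) by rewrite /rat_box ball_obox ?invr_gt0.
pose beta (k : nat) (x : Rn) : R := if unpickle k is Some b then
  (if `[< obox (lo b) (hi b) `<=` O >] then boxbump 0 (lo b) (hi b) x else 0) else 0.
have beta0 k x : 0 <= beta k x.
  rewrite /beta; case: unpickle => // b; case: asboolP => // _; exact: boxbump_ge0.
have betaO k x : ~ O x -> beta k x = 0.
  rewrite /beta; case: unpickle => // b Ox; case: asboolP => // bO.
  apply/eqP/prodf_eq0; have : ~ obox (lo b) (hi b) x by move=> /bO.
  by move=> /existsNP[i /negP H]; exists i => //; rewrite bump_eq0.
have betap x : O x -> exists k, 0 < beta k x.
  rewrite {1}(open_bigcup_rat_box oO) => -[b _].
  case: asboolP => // bO xb; exists (pickle b); rewrite /beta pickleK.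
  rewrite boxE in bO xb; case: asboolP => // _.
  by apply: prodr_gt0 => i _; apply: bump_gt0; exact: xb.
have ebeta k : elem (beta k).
  rewrite /beta; case: unpickle => [b|]; last exact: elem_cst.
  case: asboolP => _; last exact: elem_cst.
  by apply: (elem_prod (fun i => bump 0 (lo b 0 i) (hi b 0 i))) => i; exact: elem1_bump.
(* [zeta N] is positive exactly on the first [N] rational boxes inside [O]. *)
pose zeta N x := \sum_(k < N) beta k x.
have ezeta N : elem (zeta N).
  rewrite /zeta; elim: N => [|N IH].
    by under eq_fun do rewrite big_ord0; exact: elem_cst.
  by under eq_fun do rewrite big_ord_recr /=; exact: elem_add.
have zeta_nd N M x : (N <= M)%N -> zeta N x <= zeta M x.
  move=> /subnK <-; elim: (M - N)%N => [//|k IH].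
  by rewrite addSn /zeta big_ord_recr/= ler_wpDr.
pose r N : R := N.+1%:R.
have r0 N : 0 < r N by rewrite ltr0n.
pose A N := O `&` [set x | zeta N x < 2 / r N].
have czeta N := elem_continuous _ (ezeta N).
have oA N (t : R) : open [set x | zeta N x < t] by exact: open_lt_fun (czeta N).
have mA N : measurable (A N).
  by apply: measurableI => //; apply: open_measurable_mx; exact: oA.
have AO N : A N `<=` O by move=> x [].
(* At a point of [O] some [beta k] is positive; it is counted in [zeta N] once [N > k], while the
   threshold 2/(N+1) eventually drops below it. *)
have A0 : \bigcap_N A N = set0.
  apply/seteqP; split => // x xA; have [Ox _] := xA 0%N I.
  have [k bk] := betap _ Ox.
  have [m mk] : exists m, 2 / r m < beta k x.
    exists (Num.truncn (2 / beta k x)).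
    by rewrite ltr_pdivrMr// mulrC -ltr_pdivrMr// truncnS_gt.
  have [_ /=] := xA (maxn m k.+1) I; apply/negP; rewrite -leNgt.
  apply: (@le_trans _ _ (2 / r m)).
    by rewrite ler_pM2l// lef_pV2 ?posrE// ler_nat ltnS leq_maxl.
  apply: (le_trans (ltW mk)).
  apply: (@le_trans _ _ (zeta k.+1 x)); last by apply: zeta_nd; rewrite leq_maxr.
  by rewrite /zeta big_ord_recr/= lerDr sumr_ge0.
have Acvg : mu (A N) @[N --> \oo] --> 0%E.
  rewrite -(measure0 mu) -A0.
  apply: nonincreasing_cvg_mu => //.
  - by apply: le_lt_trans Ooo; apply: le_measure; rewrite ?inE.
  - by rewrite A0.
  - move=> N M NM; apply/subsetPset => x [Ox /= zx]; split => //=.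
    apply: le_lt_trans (zeta_nd _ _ _ NM) _; apply: lt_le_trans zx _.
    by rewrite ler_pM2l// lef_pV2 ?posrE// ler_nat ltnS.
have [N AN] : exists N, (mu (A N) < eps%:E)%E.
  apply: contrapT => /forallNP H.
  have : (eps%:E <= 0)%E.
    apply: (cvge_ge _ Acvg); apply: nearW => N; rewrite leNgt; exact/negP/H.
  by rewrite lee_fin leNgt eps0.
(* [c \o w] is 1 where [zeta N < 1 / r N] and 0 where [zeta N >= 2 / r N]. *)
pose w x := 2 + (- r N) * zeta N x.
have ew : elem w by apply: elem_add; [exact: elem_cst|apply: elem_mul; [exact: elem_cst|exact: ezeta]].
have [G wG] := elem_has_grad _ ew.
exists (fun x => c (w x)), (fun i x => c' (w x) * G i x), [set x | zeta N x < (r N)^-1], (A N).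
split.
- exact: has_grad_comp.
- by move=> x; exact: c01.
- split => //.
  + move=> x Ox /=; rewrite /zeta big1 ?invr_gt0// => k _; exact: betaO.
  + move=> x /= zx; apply: c1; rewrite /w.
    have : r N * zeta N x <= 1 by rewrite mulrC -ler_pdivlMr// mul1r ltW.
    by rewrite mulNr => H; lra.
- split => // x Ox xA; apply: c0; rewrite /w.
  have : 2 <= r N * zeta N x.
    rewrite mulrC -ler_pdivrMr// leNgt; apply/negP => H; apply: xA; split => //.
  by rewrite mulNr => H; lra.
Qed.

End cutoff.

(** * The boundary of a bounded domain, and small translations of compact sets *)

Section boundary_lemmas.
Context {R : realType} {n : nat}.
Local Notation Rn := 'rV[R]_n.
Local Notation mu := (vol R n).

Lemma enorm_continuous : continuous (@enorm R n).
Proof.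
have cs (s : seq 'I_n) : continuous (fun x : Rn => \sum_(i <- s) x 0 i ^+ 2).
  elim: s => [|i s IH] x.
    by under eq_fun do rewrite big_nil; exact: cst_continuous.
  under eq_fun do rewrite big_cons.
  apply: (@continuousD _ _ _ (fun x : Rn => x 0 i ^+ 2)); last exact: IH.
  apply: (@continuous_comp _ _ _ (fun y : Rn => y 0 i) (fun t : R => t ^+ 2)).
    exact: coord_continuous.
  exact: exprn_continuous.
move=> x; apply: (@continuous_comp _ _ _ (fun x : Rn => \sum_(i < n) x 0 i ^+ 2)
  (fun t : R => Num.sqrt t)); first exact: cs.
exact: sqrt_continuous.
Qed.

Lemma eball_open (x : Rn) (r : R) : open (eball x r).
Proof.
apply: open_lt_fun => y.
apply: (@continuous_comp _ _ _ (fun y : Rn => y - x) (@enorm R n)).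
  by apply: (@continuousB _ _ _ (fun y : Rn => y) (cst x)); [exact: cvg_id|exact: cst_continuous].
exact: enorm_continuous.
Qed.

Lemma eball_center (x : Rn) (r : R) : 0 < r -> eball x r x.
Proof.
move=> r0; rewrite /eball /= subrr /enorm big1 ?sqrtr0// => i _.
by rewrite mxE expr0n.
Qed.

Lemma eball_sub_ball (x : Rn) (r : R) : 0 < r -> eball x r `<=` ball x r.
Proof.
move=> r0 y xy; split => // i j; rewrite (ord1 i) /ball/= distrC.
have := coord_le_enorm (y - x) j; rewrite !mxE => /le_lt_trans; exact.
Qed.

Lemma boundaryE (Om : set Rn) : open Om -> boundary Om = closure Om `&` ~` Om.
Proof. by move=> oO; rewrite /boundary setDE (_ : interior Om = Om)//; exact/interior_id. Qed.

Lemma boundary_compact (Om : set Rn) : bounded_domain Om -> compact (boundary Om).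
Proof.
move=> [oO _ _ bO]; rewrite boundaryE//.
apply: compact_closedI; first exact: bounded_closure_compact.
exact: open_closedC.
Qed.

(** The strong extension property gives one null set per ball; covering [W] by countably many
    rational boxes, each inside a ball contained in [W], leaves a single null set. *)
Lemma strong_extension_const (Om : set Rn) (p q c : R) E (u : Rn -> R) (W : set Rn) :
  strong_extension_operator Om p q E -> W1p Om p u -> open W ->
  ae_eq_on (W `&` Om) u (fun=> c) ->
  {ae mu, forall x, W x -> boundary Om x -> E u x = c}.
Proof.
move=> [_ sE] Wu oW uc.
have : {ae mu, forall x, forall b : 'M[rat]_(1, n) * nat,
    (exists y r, @rat_box R 1 n b `<=` eball y r /\ eball y r `<=` W) ->
    @rat_box R 1 n b x -> boundary Om x -> E u x = c}.
  apply: ae_countable => b.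
  have [[y [r [bB BW]]]|H] := pselect (exists y r, @rat_box R 1 n b `<=` eball y r /\ eball y r `<=` W);
    last by apply: aeW => x /H.
  (* A ball missing [Om] contains no point of its closure, so nothing is to be shown there. *)
  have [ne|em] := pselect (eball y r `&` Om !=set0); last first.
    apply: aeW => x _ bx [clx _]; exfalso; apply: em.
    have := clx (eball y r) (open_nbhs_nbhs (conj (eball_open y r) (bB _ bx))).
    by rewrite setIC.
  have uB : ae_eq_on (eball y r `&` Om) u (fun=> c).
    by apply: filterS uc => x H [xB xO]; apply: H; split => //; exact: BW.
  have := sE u Wu y r c ne uB; apply: filterS => x H _ bx Kx; apply: H; split => //; exact: bB.
apply: filterS => x Hx Wx Kx.
have /nbhs_ballP[e /= e0 eW] : nbhs x W by exact: open_nbhs_nbhs.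
have := eball_center x e e0; rewrite {1}(open_bigcup_rat_box (eball_open x e)) => -[b _].
case: asboolP => // bB xb; apply: (Hx b) => //.
exists x, e; split => //; apply: subset_trans eW; exact: eball_sub_ball.
Qed.

(** Moved by [h v], the points of [K] that leave [K] land in V_k minus [K], where V_k is the
    1/(k+1)-neighbourhood of [K]. As [K] is closed, the V_k decrease to [K], so this difference has
    small measure for large [k]. *)
Lemma compact_shift_measure (K : set Rn) (v : Rn) (eps : R) : compact K -> 0 < eps ->
  exists2 d : R, 0 < d & forall h, 0 < h < d ->
    (mu (K `&` [set x | ~ K (x + h *: v)%R]) <= eps%:E)%E.
Proof.
move=> cK eps0; have mK := compact_measurable _ cK.
have clK : closed K by apply: compact_closed => //; exact: norm_hausdorff.
pose V (k : nat) : set Rn := \bigcup_(y in K) ball y k.+1%:R^-1.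
have oV k : open (V k) by apply: bigcup_open => y _; exact: ball_open.
have mV k : measurable (V k) by exact: open_measurable_mx.
have k0 (k : nat) : 0 < k.+1%:R^-1 :> R by rewrite invr_gt0.
have KV k : K `<=` V k by move=> x Kx; exists x => //; exact: ballxx.
have VK : \bigcap_k V k = K.
  apply/seteqP; split => [x xV|x Kx k _]; last exact: KV.
  rewrite (closure_id K).1// => B /nbhs_ballP[e /= e0 eB].
  have [k ke] := exists_invS_lt e e0.
  have [y Ky xy] := xV k I; exists y; split => //; apply: eB.
  by apply: (le_ball (ltW ke)); exact: ball_sym.
have [M [_ HM]] := compact_bounded cK.
have V0oo : (mu (V 0%N) < +oo)%E.
  apply: vol_bounded => //; exists (`|M| + 2); split; first exact: num_real.
  move=> N MN x [y Ky]; rewrite -ball_normE /= => yx.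
  have yM : `|y| <= `|M| + 1/2.
    by apply: HM => //; rewrite (le_lt_trans (ler_norm _))// ltrDl.
  rewrite -(subrK y x) (le_trans (ler_normD _ _))//.
  move: yx; rewrite distrC invr1 => yx; lra.
have Vcvg : mu (V k) @[k --> \oo] --> mu K.
  rewrite -VK; apply: nonincreasing_cvg_mu => //; first by rewrite VK.
  move=> k l kl; apply/subsetPset => x [y Ky yx]; exists y => //.
  by apply: le_ball yx; rewrite lef_pV2 ?posrE// ler_nat ltnS.
have Koo : (mu K < +oo)%E by apply: le_lt_trans V0oo; apply: le_measure; rewrite ?inE//; exact: KV.
have [k Vk] : exists k, (mu (V k) < mu K + eps%:E)%E.
  apply: contrapT => /forallNP H.
  have : (mu K + eps%:E <= mu K)%E.
    by apply: (cvge_ge _ Vcvg); apply: nearW => N; rewrite leNgt; exact/negP/H.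
  rewrite leNgt lteDl ?ge0_fin_numE//. by rewrite lte_fin eps0.
(* This forces h |v| < 1/(k+1); the summand 1 keeps the denominator positive when [v = 0]. *)
exists (k.+1%:R^-1 / (`|v| + 1)); first by rewrite divr_gt0// ltr_wpDl.
move=> h /andP[h0 hd].
pose S : set Rn := [set y | K (y - h *: v)] `&` ~` K.
have mKh : measurable [set y : Rn | K (y - h *: v)].
  rewrite -[X in measurable X]setTI; exact: (measurable_addmx _ (- (h *: v)) measurableT _ mK).
have mS : measurable S by apply: measurableI => //; exact: measurableC.
have -> : K `&` [set x | ~ K (x + h *: v)%R] = (fun x => x + h *: v) @^-1` S.
  by apply/seteqP; split => x /=; rewrite /S /= addrK.
rewrite vol_translate//.
have SV : S `<=` V k `\` K.
  move=> y [/= Ky nKy]; split => //; exists (y - h *: v) => //.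
  rewrite -ball_normE /= addrAC subrr sub0r normrN normrZ (gtr0_norm h0).
  rewrite (@le_lt_trans _ _ (h * (`|v| + 1)))// ?ler_pM2l ?lerDl//.
  by rewrite -ltr_pdivlMr// ltr_wpDl.
apply: (@le_trans _ _ (mu (V k `\` K))).
  by apply: le_measure; rewrite ?inE//; exact: measurableD.
rewrite measureD//; last by apply: le_lt_trans V0oo; apply: le_measure; rewrite ?inE// => x [y Ky yx];
  exists y => //; apply: le_ball yx; rewrite lef_pV2 ?posrE// ler_nat.
rewrite (setIidr (KV k)) leeBlDr ?ge0_fin_numE// addeC.
exact: ltW.
Qed.

End boundary_lemmas.

(** * Waves and the oscillating Sobolev functions built from them *)

Section wave_functions.
Context {R : realType}.

(** Only the phase function is recorded here. The plateaus appear on composing a smooth step with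
    1/2 + s: 0 where s < -1/2 and 1 where s > 1/2. Antiperiodicity by [pi] is what exchanges
    them. *)
Definition wave (s s' : R -> R) :=
  [/\ forall t : R, is_derive t 1 s (s' t), continuous s',
      forall t, `|s' t| <= 1 & forall t, s (t + pi) = - s t].

Lemma wave_sin : wave sin cos.
Proof.
split; [exact: is_derive_sin|exact: continuous_cos|exact: cos_max|exact: sinDpi].
Qed.

Lemma wave_cos : wave cos (fun t => - sin t).
Proof.
split; [exact: is_derive_cos| | |exact: cosDpi].
- by move=> t; apply: continuousN; exact: continuous_sin.
- by move=> t; rewrite normrN sin_max.
Qed.

Lemma waveN s s' : wave s s' -> wave (fun t => - s t) (fun t => - s' t).
Proof.
move=> [ds cs s1 sp]; split.
- by move=> t; exact: is_deriveN (ds t).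
- by move=> t; apply: continuousN; exact: cs.
- by move=> t; rewrite normrN.
- by move=> t; rewrite sp.
Qed.

(* Since cos^2 + sin^2 = 1, one of |sin|, |cos| exceeds 1/2. *)
Lemma wave_cover (t : R) :
  [\/ sin t < - 2^-1, - sin t < - 2^-1, cos t < - 2^-1 | - cos t < - 2^-1].
Proof.
have [|s1] := ltP (sin t) (- 2^-1); first by constructor 1.
have [|s2] := ltP (- sin t) (- 2^-1); first by constructor 2.
have [|c1] := ltP (cos t) (- 2^-1); first by constructor 3.
have [|c2] := ltP (- cos t) (- 2^-1); first by constructor 4.
exfalso; have := cos2Dsin2 t.
have H (z : R) : - 2^-1 <= z -> - 2^-1 <= - z -> z ^+ 2 <= 4^-1.
  move=> z1 z2; have : 0 <= (2^-1 + z) * (2^-1 - z) by rewrite mulr_ge0//; lra.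
  have -> : (2^-1 + z) * (2^-1 - z) = 4^-1 - z ^+ 2 by field.
  by rewrite subr_ge0.
have := H _ s1 s2; have := H _ c1 c2; lra.
Qed.

Context {n : nat}.
Local Notation Rn := 'rV[R]_n.
Local Notation mu := (vol R n).

(** The order of choices matters: the step bound [L] fixes how small [A] must be, then the cutoff
    and its gradient bound [B] on [Om] are fixed, and only then [h] is taken small. [V] and [d] thus
    serve all small [h]. *)
Lemma wave_test (Om : set Rn) (p rho : R) (i : 'I_n) (s s' : R -> R) :
  bounded_domain Om -> 1 <= p -> wave s s' -> 0 < rho ->
  exists V d, [/\ open V, ~` Om `<=` V, 0 < d & forall h, 0 < h < d ->
    exists u, [/\ W1p Om p u, (W1p_norm Om p u <= rho%:E)%E,
      forall x, V x -> s (pi / h * x 0 i) < - 2^-1 -> u x = 0 &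
      forall x, V x -> 2^-1 < s (pi / h * x 0 i) -> u x = h]].
Proof.
move=> [oO _ _ bO] p1 [ds cs' s1 sp] rho0.
have p0 : 0 < p by exact: lt_le_trans p1.
have mO := open_measurable_mx oO.
have Ooo := vol_bounded _ _ mO bO.
have n0 : (0 < n)%N by exact: leq_ltn_trans (ltn_ord i).
have n1 : 1 <= n%:R :> R by rewrite ler1n.
have [c [c' [L [dc cc' c0 c1 [c01 c'L]]]]] := @smooth_step R.
have L0 : 0 <= L by exact: le_trans (normr_ge0 _) (c'L 0).
have pi0 : 0 < pi :> R by exact: pi_gt0.
(* [X] bounds both [M + m] and [n%:R * M] below, since m < 1 and M <= L pi + m. *)
pose X : R := n%:R * (L * pi + 2).
have X0 : 0 < X by rewrite mulr_gt0 ?ltr0n// ltr_wpDl// mulr_ge0// ltW.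
(* The L^p norms of the function and of its gradient get rho / 2 each. Of the p-th power [t], one
   half is spent on [A], whence the bound t / (2 X^p) on its measure, and one half on [Om]. *)
pose t := (rho / 2) `^ p.
have t0 : 0 < t by rewrite powR_gt0// divr_gt0.
have [eta [G [V [A [etaG eta01 [oV OV V1] [mA AO Aeps A0]]]]]] :=
  cutoff Om (t / (2 * X `^ p)) oO Ooo (divr_gt0 t0 (mulr_gt0 (ltr0n _ 2) (powR_gt0 p X0))).
have [ceta cG deta] := etaG.
have [B B0 GB] : exists2 B, 0 <= B & forall x j, Om x -> `|G j x| <= B.
  have cO := bounded_closure_compact _ bO.
  have H j : exists C, 0 <= C /\ forall x, closure Om x -> `|G j x| <= C.
    by have [C C0 HC] := continuous_bounded_compact _ _ cO (cG j); exists C.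
  pose C j := sval (cid (H j)).
  have CP j : 0 <= C j /\ forall x, closure Om x -> `|G j x| <= C j by rewrite /C; case: cid.
  exists (\sum_j C j); first by apply: sumr_ge0 => j _; exact: (CP j).1.
  move=> x j Ox; apply: (le_trans ((CP j).2 x (subset_closure Ox))).
  by rewrite (bigD1 j)//= lerDl sumr_ge0// => k _; exact: (CP k).1.
pose vO := fine (mu Om).
have vO0 : 0 <= vO by rewrite fine_ge0.
have vOE : mu Om = vO%:E by rewrite fineK// ge0_fin_numE.
(* A constant bound [y] on [Om] contributes y^p |Om| <= t / 2. *)
pose y := (t / (2 * (vO + 1))) `^ p^-1.
have vO1 : 0 < vO + 1 by rewrite ltr_wpDl.
have y0 : 0 < y by rewrite powR_gt0// divr_gt0// mulr_gt0.
have yp : y `^ p = t / (2 * (vO + 1)).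
  by rewrite -powRrM mulVf ?gt_eqF// powRr1// ltW// divr_gt0// mulr_gt0.
have B1 : 0 < B + 1 by rewrite ltr_wpDl.
(* The number m = h (B + 1) dominates both [h], the bound on |u|, and [h * B], the cutoff part of
   the gradient; h < d says exactly that m < 1 and m < y / n. *)
exists V, (Num.min 1 (y / n%:R) / (B + 1)); split => //.
  by rewrite divr_gt0// lt_min ltr01 divr_gt0// ltr0n.
move=> h /andP[h0 hd].
pose m := h * (B + 1).
have m0 : 0 <= m by rewrite mulr_ge0 ?(ltW h0) ?(ltW B1).
have : m < Num.min 1 (y / n%:R) by rewrite /m -ltr_pdivlMr.
rewrite lt_min => /andP[m1]; rewrite ltr_pdivlMr ?ltr0n// => my.
pose M := L * pi + h * B.
have M0 : 0 <= M by rewrite addr_ge0// mulr_ge0// ltW.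
have hBm : h * B <= m by rewrite ler_pM2l// lerDl.
have hm : h <= m by rewrite ler_peMr ?(ltW h0)// lerDr.
(* The phase advances by [pi], half a period, when the coordinate advances by [h]. *)
pose om := pi / h.
pose W (r : R) := h * c (2^-1 + s (om * r)).
pose w (r : R) := h * (c' (2^-1 + s (om * r)) * (s' (om * r) * om)).
have dW (r : R) : is_derive r 1 W (w r).
  have d1 : is_derive r 1 (fun r : R => om * r) om.
    by have := is_deriveZ om (is_derive_id r 1); rewrite /GRing.scale/= mulr1.
  have d2 : is_derive r 1 (fun r => s (om * r)) (s' (om * r) * om).
    exact: (@is_derive1_comp R s (fun r => om * r) r _ _ (ds _) d1).
  have d3 : is_derive r 1 (fun r => 2^-1 + s (om * r)) (s' (om * r) * om).
    by have := is_deriveD (is_derive_cst (2^-1 : R) r 1) d2; rewrite add0r.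
  have d4 := @is_derive1_comp R c (fun r => 2^-1 + s (om * r)) r _ _ (dc _) d3.
  have H : is_derive r 1 (fun r => h * c (2^-1 + s (om * r)))
    (h * (c' (2^-1 + s (om * r)) * (s' (om * r) * om))) := is_deriveZ h d4.
  exact: H.
have cs : continuous s by move=> r; exact: is_derive1_continuous (ds r).
have clin : continuous (fun r : R => om * r).
  move=> r; apply: (@continuousM _ _ (cst om) (fun r : R => r)); last exact: cvg_id.
  exact: cst_continuous.
have cw : continuous w.
  move=> r; apply: (@continuousM _ _ (cst h) (fun r => c' (2^-1 + s (om * r)) * (s' (om * r) * om))).
    exact: cst_continuous.
  apply: (@continuousM _ _ (fun r => c' (2^-1 + s (om * r))) (fun r => s' (om * r) * om)).
    apply: (@continuous_comp _ _ _ (fun r => 2^-1 + s (om * r)) c'); last exact: cc'.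
    apply: (@continuousD _ _ _ (cst (2^-1 : R)) (fun r => s (om * r))); first exact: cst_continuous.
    by apply: (@continuous_comp _ _ _ (fun r => om * r) s); [exact: clin|exact: cs].
  apply: (@continuousM _ _ (fun r => s' (om * r)) (cst om)); last exact: cst_continuous.
  by apply: (@continuous_comp _ _ _ (fun r => om * r) s'); [exact: clin|exact: cs'].
have uG := has_grad_mul _ _ _ _ (has_grad_coord W w i dW cw) etaG.
set u := (fun x : Rn => W (x 0 i) * eta x) in uG.
have W01 r : 0 <= W r <= h.
  have /andP[? ?] := c01 (2^-1 + s (om * r)).
  by rewrite /W mulr_ge0 ?(ltW h0)//= ler_piMr// ltW.
have wL r : `|w r| <= L * pi.
  have om0 : 0 < om by rewrite divr_gt0.
  rewrite /w.
  (* The amplitude [h] cancels the denominator of the frequency pi / h, so the slope bound L pi does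
     not depend on [h]. *)
  rewrite (_ : `|_| = h * (`|c' (2^-1 + s (om * r))| * (`|s' (om * r)| * (pi / h)))); last first.
    by rewrite normrM (gtr0_norm h0) normrM normrM (gtr0_norm om0).
  rewrite (_ : h * _ = `|c' (2^-1 + s (om * r))| * (`|s' (om * r)| * pi)).
    apply: ler_pM => //; first by rewrite mulr_ge0// ltW.
    by rewrite ler_piMl// ltW.
  by field; exact: lt0r_neq0.
exists u.
have [Wu uN] : W1p Om p u /\
  (W1p_norm Om p u <=
   (((M + m) `^ p)%:E * mu A + (m `^ p)%:E * mu Om) `^ p^-1 +
   (((n%:R * M) `^ p)%:E * mu A + ((n%:R * m) `^ p)%:E * mu Om) `^ p^-1)%E.
  apply: (W1p_C1 _ _ _ _ _ _ _ oO Ooo mA AO p1 M0 m0 uG).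
  - move=> x Ox; rewrite /u normrM; have /andP[? ?] := W01 (x 0 i).
    have /andP[? ?] := eta01 x; rewrite !ger0_norm//.
    by apply: le_trans hm; apply: (@le_trans _ _ (h * 1)); [exact: ler_pM|rewrite mulr1].
  - move=> x j Ox.
    have H1 : `|W (x 0 i) * G j x| <= h * B.
      rewrite normrM; apply: ler_pM => //; last exact: GB.
      by have /andP[? ?] := W01 (x 0 i); rewrite ger0_norm.
    case: (boolP (x \in A)) => xA; last first.
      rewrite A0//; last by move=> H; move/negP: xA; apply; rewrite inE.
      by rewrite mul0r addr0; exact: le_trans hBm.
    rewrite /M addrC (le_trans (ler_normD _ _))// lerD// normrM.
    have /andP[? ?] := eta01 x.
    rewrite -[leRHS]mul1r; apply: ler_pM => //; first by rewrite ger0_norm.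
    rewrite normrM; case: eqP => _; rewrite ?normr1 ?normr0 ?mul1r ?mul0r//.
    by rewrite mulr_ge0// ltW.
split => //.
- apply: le_trans uN _.
  have main a b : 0 <= a <= X -> 0 <= b <= y ->
      (((a `^ p)%:E * mu A + (b `^ p)%:E * mu Om) `^ p^-1 <= (rho / 2)%:E)%E.
    move=> /andP[a0 aX] /andP[b0 by_].
    have -> : (rho / 2)%:E = (t%:E `^ p^-1)%E.
      rewrite poweR_EFin -powRrM mulfV ?gt_eqF// powRr1//.
      by rewrite ltW// divr_gt0.
    apply: gt0_ler_poweR.
    + by rewrite invr_ge0 ltW.
    + by rewrite in_itv/= leey andbT adde_ge0// mule_ge0// lee_fin powR_ge0.
    + by rewrite in_itv/= leey andbT lee_fin ltW.
    have tE : t = X `^ p * (t / (2 * X `^ p)) + t / 2.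
      have := powR_gt0 p X0 => Xp; field; exact: lt0r_neq0.
    rewrite [leRHS](_ : _ = (X `^ p)%:E * (t / (2 * X `^ p))%:E + (t / 2)%:E)%E; last first.
      by rewrite -EFinM -EFinD -tE.
    apply: leeD.
      apply: lee_pmul => //; [by rewrite lee_fin powR_ge0| |exact: ltW].
      by rewrite lee_fin ge0_ler_powR ?nnegrE// ltW.
    rewrite vOE -EFinM lee_fin.
    apply: (@le_trans _ _ (y `^ p * (vO + 1))).
      apply: ler_pM => //; first by rewrite powR_ge0.
        by apply: ge0_ler_powR; rewrite ?nnegrE// ltW.
      by rewrite lerDl.
    by rewrite yp le_eqVlt; apply/orP; left; apply/eqP; field; exact: lt0r_neq0.
  rewrite [leRHS](_ : _ = (rho / 2)%:E + (rho / 2)%:E)%E; last by rewrite -EFinD -splitr.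
  have MX : M + m <= L * pi + 2 by rewrite /M; lra.
  apply: leeD; apply: main; apply/andP; split.
  + by rewrite addr_ge0.
  + apply: le_trans MX _; rewrite /X ler_peMl//.
    by rewrite addr_ge0// mulr_ge0// ltW.
  + by [].
  + by apply: le_trans (ltW my); rewrite ler_peMr.
  + by rewrite mulr_ge0.
  + rewrite /X ler_pM2l ?ltr0n//; lra.
  + by rewrite mulr_ge0.
  + by rewrite mulrC ltW.
- move=> x Vx sx; rewrite /u /W c0 ?mulr0 ?mul0r//.
  by rewrite /om; lra.
- move=> x Vx sx; rewrite /u /W c1 ?V1// ?mulr1//.
  by rewrite /om; lra.
Qed.

Lemma opnorm_bound (Om : set Rn) (p q : R) E : (opnorm Om p q E < +oo)%E ->
  exists2 C, 0 <= C & forall u rho, W1p Om p u -> ~ ae_eq_on Om u (fun=> 0) ->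
    (W1p_norm Om p u <= rho%:E)%E -> (W1p_norm setT q (E u) <= (C * rho)%:E)%E.
Proof.
move=> Eoo; exists `|fine (opnorm Om p q E)| => // u rho Wu nz urho.
have norm0 (O : set Rn) r (v : Rn -> R) : (0 <= W1p_norm O r v)%E.
  by rewrite adde_ge0// Lnorm_ge0.
have H : (W1p_norm setT q (E u) / W1p_norm Om p u <= opnorm Om p q E)%E.
  by apply: ereal_sup_ubound; exists u.
move: H (norm0 setT q (E u)) (norm0 Om p u) Eoo urho.
move: (W1p_norm setT q (E u)) (W1p_norm Om p u) (opnorm Om p q E) => x y z.
case: y => [y| |]//= H x0 y0 zoo; rewrite ?lee_fin// => yr.
have z0 : (0 <= z)%E by apply: le_trans H; rewrite mule_ge0// inve_ge0.
have zf : z \is a fin_num by rewrite ge0_fin_numE.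
move: H z0; rewrite -(fineK zf) => {zoo zf}; move: (fine z) => {}z H z0.
rewrite /= ger0_norm//.
(* The inverse of 0 is [+oo], so if the norm of [u] is 0, finiteness of the supremum forces the norm
   of [E u] to be 0. *)
move: y0; rewrite lee_fin le_eqVlt => /predU1P[y0|y0].
  move: H; rewrite -y0 inve0.
  case: x x0 => [x| |]//; rewrite lee_fin le_eqVlt => /predU1P[<-|x0].
    by rewrite lee_fin mulr_ge0// (le_trans _ yr)// -y0.
  by rewrite gt0_muley ?lte_fin// leye_eq.
move: H; rewrite inver gt_eqF//.
case: x x0 => [x| |]// x0; last by rewrite gt0_mulye ?lte_fin ?invr_gt0// leye_eq.
rewrite -EFinM !lee_fin ler_pdivrMr// => /le_trans; apply.
by rewrite ler_wpM2l.
Qed.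

End wave_functions.

(** * Strong extension operators *)

Section strong_extension.
Context {R : realType} {n : nat}.
Local Notation Rn := 'rV[R]_n.
Local Notation mu := (vol R n).

Lemma wave_continuous (s s' : R -> R) (om : R) (i : 'I_n) : wave s s' ->
  continuous (fun x : Rn => s (om * x 0 i)).
Proof.
move=> [ds _ _ _] x; apply: (@continuous_comp _ _ _ (fun x : Rn => om * x 0 i) s).
  apply: (@continuousM _ _ (cst om) (fun x : Rn => x 0 i)); first exact: cst_continuous.
  exact: coord_continuous.
exact: is_derive1_continuous (ds _).
Qed.

Lemma compact_sub_obox (K : set Rn) : compact K -> exists a b, K `<=` obox a b.
Proof.
move=> cK; have [M [_ HM]] := compact_bounded cK.
exists (const_mx (- (`|M| + 2))), (const_mx (`|M| + 2)) => x Kx i; rewrite !mxE -ltr_norml.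
apply: le_lt_trans (coord_le_norm _ x i) _.
apply: (@le_lt_trans _ _ (`|M| + 1)); last by rewrite ltrD2l ltr1n.
by apply: HM => //; rewrite (le_lt_trans (ler_norm _))// ltrDl.
Qed.

Lemma integral_grad_le (v : Rn -> R) (q B : R) i : 1 <= q -> 0 <= B ->
  weak_gradient setT v (grad setT v) -> (W1p_norm setT q v <= B%:E)%E ->
  (\int[mu]_x (`|grad setT v x 0 i| `^ q)%:E <= (B `^ q)%:E)%E.
Proof.
move=> q1 B0 [_ lg _] vB; have q0 : 0 < q by exact: lt_le_trans q1.
set g := grad setT v in lg *.
have me : measurable_fun setT (fun x => enorm (g x)).
  by apply: measurable_enorm => // j; exact: (lg j).1.
have LB : (Lp_norm setT q (@enorm R n \o g) <= B%:E)%E.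
  by apply: le_trans vB; rewrite /W1p_norm leeDr// Lnorm_ge0.
apply: (@le_trans _ _ (Lp_norm setT q (@enorm R n \o g) `^ q)%E); last first.
  rewrite -poweR_EFin; apply: gt0_ler_poweR => //; first exact: ltW.
  - by rewrite in_itv/= leey andbT Lnorm_ge0.
  - by rewrite in_itv/= leey andbT lee_fin.
rewrite /Lp_norm powR_Lnorm ?gt_eqF// patch_setT.
apply: ge0_le_integral => //.
- apply/measurable_EFinP; apply: (measurableT_comp (measurable_powR _)).
  by apply: measurableT_comp => //; exact: (lg i).1.
- apply: (measurableT_comp (measurable_poweR _)).
  by apply: measurableT_comp => //; apply/measurable_EFinP.
move=> x _; rewrite /= lee_fin; apply: ge0_ler_powR; rewrite ?nnegrE//; first exact: ltW.
by rewrite [leRHS]ger0_norm ?enorm_ge0// coord_le_enorm.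
Qed.

(** With jump and step both equal to [h], [shift_measure_le] reads |A| <= |A|/2 + 2^(q-1) I, where I
    is the integral of |d_i (E u)|^q and is at most (C rho)^q. Hence |A| <= (2 C rho)^q. *)
Lemma strong_extension_wave (Om : set Rn) (p q eps : R) E i (s s' : R -> R) :
  bounded_domain Om -> 1 <= q -> q <= p -> strong_extension_operator Om p q E ->
  wave s s' -> 0 < eps ->
  exists2 d, 0 < d & forall h, 0 < h < d ->
    (mu (boundary Om `&` [set x | boundary Om (x + h *: delta_mx 0 i)%R] `&`
      [set x | (s (pi / h * x 0 i) < - 2^-1)%R]) <= eps%:E)%E.
Proof.
move=> bd q1 qp sE ws eps0.
have [oO _ _ _] := bd; have [ds _ _ sp] := ws.
have p1 : 1 <= p by exact: le_trans qp.
have q0 : 0 < q by exact: lt_le_trans q1.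
have [[Emaps _ _ Eoo] _] := sE.
have [C C0 HC] := opnorm_bound _ _ _ _ Eoo.
have C1 : 0 < C + 1 by rewrite ltr_wpDl.
(* Then 2 C rho = eps^(1/q) C / (C + 1), whose q-th power is at most [eps]; [C + 1] covers the case
   C = 0. *)
pose rho := eps `^ q^-1 / (2 * (C + 1)).
have rho0 : 0 < rho by rewrite divr_gt0 ?powR_gt0// mulr_gt0.
have [V [d [oV OV d0 Hd]]] := wave_test Om p rho i s s' bd p1 ws rho0.
exists d => // h hd; have [u [Wu uN u0 uh]] := Hd h hd.
have /andP[h0 _] := hd.
set K := boundary Om; set e : Rn := delta_mx 0 i.
have cK : compact K by exact: boundary_compact.
have mK := compact_measurable _ cK.
have KV : K `<=` V by move=> x; rewrite /K boundaryE// => -[_ /OV].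
set A := _ `&` _ `&` _.
have cphase := wave_continuous s s' (pi / h) i ws.
have olt := open_lt_fun _ (- 2^-1) cphase.
have ogt := open_gt_fun _ 2^-1 cphase.
have mA : measurable A.
  apply: measurableI; last exact: open_measurable_mx.
  apply: measurableI => //; rewrite -[X in measurable X]setTI.
  exact: (measurable_addmx _ (h *: e) measurableT _ mK).
have Eu0 : {ae mu, forall x, (V `&` [set x | s (pi / h * x 0 i) < - 2^-1]) x -> K x -> E u x = 0}.
  apply: (strong_extension_const _ _ _ _ _ _ _ sE Wu); first exact: openI.
  by apply: aeW => x [[Vx sx] _]; exact: u0.
have Euh : {ae mu, forall x, (V `&` [set x | 2^-1 < s (pi / h * x 0 i)]) x -> K x -> E u x = h}.
  apply: (strong_extension_const _ _ _ _ _ _ _ sE Wu); first exact: openI.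
  by apply: aeW => x [[Vx sx] _]; exact: uh.
(* The translation by [h] adds [pi] to the phase and flips the sign of [s], so the translate lies
   over the upper plateau. *)
have Ash x : A x -> [/\ K x, K (x + h *: e), s (pi / h * x 0 i) < - 2^-1 &
    2^-1 < s (pi / h * (x + h *: e) 0 i)].
  move=> [[Kx Kxh] /= sx]; split => //.
  rewrite !mxE !eqxx /= mulr1 mulrDr mulfVK ?gt_eqF// sp; lra.
have Euh' := ae_translate _ (h *: e) _ Euh.
have vA : {ae mu, forall x, A x -> E u (x + h *: e) - E u x = h}.
  apply: filterS2 Eu0 Euh' => x /= H0 Hh /Ash[Kx Kxh s1 s2].
  by rewrite Hh// ?H0 ?subr0//; split => //; exact: KV.
(* [opnorm] says nothing about [E u] when [u] vanishes, but then the strong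
   extension property gives both E u = 0 and E u = h on the boundary. *)
have [nz|nz] := pselect (ae_eq_on Om u (fun=> 0)).
  have Z : {ae mu, forall x, setT x -> K x -> E u x = 0}.
    apply: (strong_extension_const _ _ _ _ _ _ _ sE Wu); first exact: openT.
    by apply: filterS nz => x H [_ Ox]; exact: H.
  have Z' := ae_translate _ (h *: e) _ Z.
  suff -> : mu A = 0%E by rewrite lee_fin ltW.
  apply/negligibleP => //.
  have : {ae mu, forall x, ~ A x}.
    apply: filterS3 Z Z' vA => x /= H1 H2 H3 Ax; have [Kx Kxh _ _] := Ash _ Ax.
    have := H3 Ax; rewrite (H1 I Kx) (H2 I Kxh) subrr => /eqP.
    by rewrite lt_eqF.
  by apply: negligibleS => x /= Ax; apply.
have EuB := HC u rho Wu nz uN.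
(* [E u] lies in the Sobolev space of the whole space, so [grad] selects a genuine weak gradient and
   not its default 0. *)
have wg : weak_gradient setT (E u) (grad setT (E u)).
  have [_ _ [g wg _]] := Emaps _ Wu.
  by rewrite /grad; case: xgetP => // H; have := H g.
have [a0 [b0 Kab]] := compact_sub_obox _ cK.
have Aab : A `<=` obox a0 b0 by move=> x /Ash[Kx _ _ _]; exact: Kab.
have := shift_measure_le i h h0 _ _ A a0 b0 h q wg mA Aab (ltW h0) q1 vA.
have Crho0 : 0 <= C * rho by rewrite mulr_ge0// ltW.
have IB := integral_grad_le _ _ _ i q1 Crho0 wg EuB.
have Aoo : (mu A < +oo)%E.
  apply: le_lt_trans (vol_bounded _ _ mK (compact_bounded cK)).
  by apply: le_measure; rewrite ?inE// => x /Ash[].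
have : mu A \is a fin_num by rewrite ge0_fin_numE.
move=> /fineK <-; move: (fine (mu A)) => a.
have I0 : (0 <= \int[mu]_x (`|grad setT (E u) x 0 i| `^ q)%:E)%E.
  by apply: integral_ge0 => x _; rewrite lee_fin powR_ge0.
have : (\int[mu]_x (`|grad setT (E u) x 0 i| `^ q)%:E)%E \is a fin_num.
  by rewrite ge0_fin_numE// (le_lt_trans IB)// ltry.
move=> /fineK H; move: IB; rewrite -{}H; move: (fine _) => I1.
rewrite lee_fin => IB.
rewrite -[X in (_ <= X)%E -> _]/((h * (2^-1 * a + 2 `^ (q - 1) * I1))%:E).
rewrite -EFinM !lee_fin ler_pM2l// => aI.
have qq : 2 * (2 `^ (q - 1) * (C * rho) `^ q) = (2 * (C * rho)) `^ q.
  rewrite [in RHS]powRM// powRB ?powRr1//; last by rewrite ?pnatr_eq0// implybT.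
  by field.
have : (2 * (C * rho)) `^ q <= eps.
  rewrite [leRHS](_ : eps = (eps `^ q^-1) `^ q); last first.
    by rewrite -powRrM mulVf ?gt_eqF// powRr1// ltW.
  have Crho : 2 * (C * rho) <= eps `^ q^-1.
    have -> : 2 * (C * rho) = eps `^ q^-1 * (C / (C + 1)).
      by rewrite /rho; field; exact: lt0r_neq0.
    by rewrite ler_piMr ?powR_ge0// ler_pdivrMr// mul1r lerDl.
  by apply: ge0_ler_powR => //; [exact: ltW|rewrite nnegrE mulr_ge0|rewrite nnegrE powR_ge0].
rewrite -qq => H.
have : 2 `^ (q - 1) * I1 <= 2 `^ (q - 1) * (C * rho) `^ q by rewrite ler_wpM2l// powR_ge0.
lra.
Qed.

Lemma strong_extension_boundary_null (Om : set Rn) (p q : R) E (i : 'I_n) :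
  bounded_domain Om -> 1 <= q -> q <= p -> strong_extension_operator Om p q E ->
  mu (boundary Om) = 0%E.
Proof.
move=> bd q1 qp sE.
have cK := boundary_compact _ bd; have mK := compact_measurable _ cK.
have Koo : (mu (boundary Om) < +oo)%E by apply: vol_bounded => //; exact: compact_bounded.
apply/eqP/negPn/negP => K0.
pose k := fine (mu (boundary Om)).
have kE : mu (boundary Om) = k%:E by rewrite fineK// ge0_fin_numE.
have k0 : 0 < k by rewrite fine_gt0// lt0e K0 Koo measure_ge0.
(* Five sets cover the boundary, four phases and the points pushed out of it. At k / 16 each, their
   total 5 k / 16 stays below [k]. *)
have e0 : 0 < k / 16 by rewrite divr_gt0.
have [d1 d10 H1] := strong_extension_wave Om p q _ E i _ _ bd q1 qp sE wave_sin e0.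
have [d2 d20 H2] := strong_extension_wave Om p q _ E i _ _ bd q1 qp sE (waveN _ _ wave_sin) e0.
have [d3 d30 H3] := strong_extension_wave Om p q _ E i _ _ bd q1 qp sE wave_cos e0.
have [d4 d40 H4] := strong_extension_wave Om p q _ E i _ _ bd q1 qp sE (waveN _ _ wave_cos) e0.
have [d5 d50 H5] := compact_shift_measure _ (delta_mx 0 i) _ cK e0.
pose d := Num.min (Num.min d1 d2) (Num.min (Num.min d3 d4) d5).
have d0 : 0 < d by rewrite !lt_min d10 d20 d30 d40 d50.
pose h := d / 2.
have h0 : 0 < h by rewrite divr_gt0.
have : h < d by rewrite ltr_pdivrMr// ltr_pMr// ltr1n.
rewrite !lt_min => /andP[/andP[hd1 hd2] /andP[/andP[hd3 hd4] hd5]].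
have h_ dd : h < dd -> 0 < h < dd by move=> ->; rewrite h0.
have {}H1 := H1 h (h_ _ hd1); have {}H2 := H2 h (h_ _ hd2).
have {}H3 := H3 h (h_ _ hd3); have {}H4 := H4 h (h_ _ hd4).
have {}H5 := H5 h (h_ _ hd5).
have mKh : measurable [set x : Rn | boundary Om (x + h *: delta_mx 0 i)].
  rewrite -[X in measurable X]setTI.
  exact: (measurable_addmx _ (h *: delta_mx 0 i) measurableT _ mK).
have mph (s s' : R -> R) : wave s s' ->
    measurable (boundary Om `&` [set x | boundary Om (x + h *: delta_mx 0 i)] `&`
      [set x | s (pi / h * x 0 i) < - 2^-1]).
  move=> ws; apply: measurableI; first exact: measurableI.
  by apply: open_measurable_mx; apply: open_lt_fun; exact: wave_continuous ws.
move: H1 H2 H3 H4 H5 (mph _ _ wave_sin) (mph _ _ (waveN _ _ wave_sin))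
  (mph _ _ wave_cos) (mph _ _ (waveN _ _ wave_cos)).
set A1 := (X in mu X); set A2 := (X in _ -> (mu X <= _)%E -> _).
set A3 := (X in _ -> _ -> (mu X <= _)%E -> _).
set A4 := (X in _ -> _ -> _ -> (mu X <= _)%E -> _).
set A5 := (X in _ -> _ -> _ -> _ -> (mu X <= _)%E -> _).
move=> H1 H2 H3 H4 H5 m1 m2 m3 m4.
have m5 : measurable A5 by apply: measurableI => //; exact: measurableC.
have cover : boundary Om `<=` A1 `|` A2 `|` A3 `|` A4 `|` A5.
  move=> x Kx; have [Kh|Kh] := pselect (boundary Om (x + h *: delta_mx 0 i)); last by right.
  by left; have [] := wave_cover (pi / h * x 0 i) => sx;
    [left; left; left|left; left; right|left; right|right].
have m12 := measurableU _ _ m1 m2; have m123 := measurableU _ _ m12 m3.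
have m1234 := measurableU _ _ m123 m4; have m12345 := measurableU _ _ m1234 m5.
have : (mu (boundary Om) <= mu (A1 `|` A2 `|` A3 `|` A4 `|` A5))%E.
  by apply: le_measure; rewrite ?inE.
have U1 := measureU2 mu m1234 m5; have U2 := measureU2 mu m123 m4.
have U3 := measureU2 mu m12 m3; have U4 := measureU2 mu m1 m2.
rewrite kE => /le_trans /(_ U1) /le_trans /(_ (leeD U2 H5)).
move=> /le_trans /(_ (leeD (leeD U3 H4) (lexx _))).
move=> /le_trans /(_ (leeD (leeD (leeD U4 H3) (lexx _)) (lexx _))).
move=> /le_trans /(_ (leeD (leeD (leeD (leeD H1 H2) (lexx _)) (lexx _)) (lexx _))).
rewrite -!EFinD lee_fin; lra.
Qed.

End strong_extension.

Theorem theorem1p6 (R : realType) (n : nat) (n_ge2 : (2 <= n)%N)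
    (Om : set 'rV[R]_n) (p q : R) (q_ge1 : 1 <= q) (le_qp : q <= p)
    (ext_Om : sobolev_extension_domain Om p q) :
  (exists Es, strong_extension_operator Om p q Es) <->
  vol R n (boundary Om) = 0%E.
Proof.
have [bd [E bE]] := ext_Om; split => [[Es sE]|K0].
  (* [ltnW n_ge2] proves [0 < n], so the translations run along coordinate 0. *)
  exact: (strong_extension_boundary_null Om p q Es (Ordinal (ltnW n_ge2)) bd q_ge1 le_qp sE).
exists E; split => // u _ x r c _ _.
have mK := compact_measurable _ (boundary_compact _ bd).
exists (boundary Om); split; [exact: mK|exact: K0|move=> y /= H].
by apply: contrapT => yK; apply: H => -[_ /yK].
Qed.
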